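(* The set $\mathcal{UTOURM}$ is a dense $G_\delta$ subset of $\mathcal M_0^{\mathbb N}$.
   Context: $\mathcal M$ is the space of Borel probability measures on $[0,1]$ with the weak$^*$ topology (a compact metrizable space). $\mu\in\mathcal M$ is proper if $\int_0^1x\,\mu(dx)=\tfrac12$; $\mathcal M_0$ is the set of proper measures. $\mu$ is continuous if it has no atoms and every nonempty open subset of $[0,1]$ has positive measure; $\mathcal M^c_0$ is the set of continuous proper measures. $\mathcal M_0^{\mathbb N}$ has the product topology. For $\boldsymbol\mu=(\mu_1,\mu_2,\dots)$, identified with the product measure on $[0,1]^{\mathbb N}$, $U[\boldsymbol\mu]$ is the digraph on $\mathbb N$ with $(i,j)\in U[\boldsymbol\mu]$ iff $\boldsymbol\mu(\{\mathbf x:x_i>x_j\})>\tfrac12$. $\mathcal{UTOURM}$ is the set of $\boldsymbol\mu\in(\mathcal M_0^c)^{\mathbb N}$ such that $U[\boldsymbol\mu]$ is a universal tournament, where a tournament $(T,U)$ is universal if for every tournament $R$ on a countable set $S$, every finite $S_0\subset S$ and every embedding $\phi:R\cap(S_0\times S_0)\to U$ (injective, $i\to j$ iff $\phi(i)\to\phi(j)$), there is an embedding $\psi:R\to U$ extending $\phi$. *)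

(* Defs.v *)
From HB Require Import structures.
From mathcomp Require Import all_boot all_order all_algebra.
From mathcomp Require Import all_classical all_reals all_analysis.
Set Implicit Arguments. Unset Strict Implicit. Unset Printing Implicit Defensive.
Import Order.TTheory GRing.Theory Num.Theory.
Import numFieldNormedType.Exports.
Local Open Scope classical_set_scope.
Local Open Scope ring_scope.

Definition I01 (R : realType) : set R := [set` `[0%R, 1%R]].
Arguments I01 R : clear implicits.

(* A Borel probability measure on [0,1] is represented as a Borel probability
   measure P on R (R carries its Borel sigma-algebra in MathComp-Analysis)
   with P([0,1]) = 1. *)
Definition on01 (R : realType) (P : probability R R) : Prop :=
  P (I01 R) = 1%E.

Definition proper_meas (R : realType) (P : probability R R) : Prop :=
  (\int[P]_(x in (I01 R)) (x%:E) = (2^-1)%:E)%E.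

Definition continuous_meas (R : realType) (P : probability R R) : Prop :=
  (forall x : R, P [set x] = 0%E) /\
  (forall U : set R, open U -> (U `&` (I01 R)) !=set0 ->
     (0 < P (U `&` (I01 R)))%E).

Definition in_M0 (R : realType) (P : probability R R) : Prop :=
  on01 P /\ proper_meas P.
Definition in_M0seq (R : realType) (mu : nat -> probability R R) : Prop :=
  forall n, in_M0 (mu n).

(* the digraph U[mu]: (i,j) edge iff i <> j and mu{x : x_i > x_j} > 1/2,
   computed through the two-dimensional marginal mu_i (x) mu_j of the
   product measure. *)
Definition Udigraph (R : realType) (mu : nat -> probability R R) (i j : nat) : Prop :=
  i <> j /\ ((2^-1)%:E < (mu i \x mu j)%E [set p : R * R | (p.2 < p.1)%R])%E.

Definition is_tournament (S : Type) (E : S -> S -> Prop) : Prop :=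
  (forall i, ~ E i i) /\
  (forall i j, i <> j -> (E i j \/ E j i) /\ ~ (E i j /\ E j i)).

Definition embedding_on (S T : Type) (S0 : set S) (E : S -> S -> Prop)
  (U : T -> T -> Prop) (phi : S -> T) : Prop :=
  (forall i j, S0 i -> S0 j -> phi i = phi j -> i = j) /\
  (forall i j, S0 i -> S0 j -> (E i j <-> U (phi i) (phi j))).

Definition universal_tournament (T : Type) (U : T -> T -> Prop) : Prop :=
  is_tournament U /\
  forall (S : Type) (E : S -> S -> Prop) (S0 : set S) (phi : S -> T),
    countable [set: S] -> is_tournament E -> finite_set S0 ->
    embedding_on S0 E U phi ->
    exists psi : S -> T, embedding_on setT E U psi /\
      (forall i, S0 i -> psi i = phi i).

Definition UTOURM (R : realType) (mu : nat -> probability R R) : Prop :=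
  (forall n, in_M0 (mu n) /\ continuous_meas (mu n)) /\
  universal_tournament (Udigraph mu).

(* Weak-* product topology on M^N, relativized to M_0^N.
   A basic neighbourhood of mu is given by finitely many coordinates idx i,
   continuous test functions fs i on [0,1], and eps > 0. *)
Definition test_int (R : realType) (P : probability R R) (f : R -> R) : \bar R :=
  (\int[P]_(x in (I01 R)) (f x)%:E)%E.

Definition basic_nbhd (R : realType) (mu : nat -> probability R R)
  (k : nat) (idx : 'I_k -> nat) (fs : 'I_k -> R -> R) (eps : R)
  (nu : nat -> probability R R) : Prop :=
  forall i : 'I_k,
    (`| test_int (nu (idx i)) (fs i) - test_int (mu (idx i)) (fs i) | < eps%:E)%E.

Definition nbhd_data (R : realType) (k : nat) (fs : 'I_k -> R -> R) (eps : R) : Prop :=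
  0 < eps /\ forall i : 'I_k, {within I01 R, continuous (fs i)}.

Definition rel_open (R : realType) (A : set (nat -> probability R R)) : Prop :=
  forall mu, in_M0seq mu -> A mu ->
    exists k (idx : 'I_k -> nat) (fs : 'I_k -> R -> R) (eps : R),
      nbhd_data fs eps /\
      forall nu, in_M0seq nu -> basic_nbhd mu idx fs eps nu -> A nu.

Definition rel_Gdelta (R : realType) (A : set (nat -> probability R R)) : Prop :=
  (forall mu, A mu -> in_M0seq mu) /\
  exists G : nat -> set (nat -> probability R R),
    (forall n, rel_open (G n)) /\
    forall mu, A mu <-> (in_M0seq mu /\ forall n, G n mu).

Definition rel_dense (R : realType) (A : set (nat -> probability R R)) : Prop :=
  forall mu, in_M0seq mu ->
    forall k (idx : 'I_k -> nat) (fs : 'I_k -> R -> R) (eps : R),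
      nbhd_data fs eps ->
      exists nu, A nu /\ basic_nbhd mu idx fs eps nu.

(* Main.v *)
Require Import Defs.
From HB Require Import structures.
From mathcomp Require Import all_boot all_order all_algebra.
From mathcomp Require Import all_classical all_reals all_analysis.
From mathcomp Require Import measurable_realfun.
From mathcomp Require Import ring lra.
Set Implicit Arguments.
Unset Strict Implicit.
Unset Printing Implicit Defensive.
Import Order.TTheory GRing.Theory Num.Theory.
Import numFieldNormedType.Exports.
Local Open Scope classical_set_scope.
Local Open Scope ring_scope.

(** Write [H_nu x = nu ]-oo, x[], so that [(mu \x nu) {y < x}] is the integral
    of [H_nu] against [mu].

    [G_delta]: a tournament on [nat] is universal iff it has the one-vertex
    extension property, so [UTOURM] is cut out of [M_0^N] by countably many
    conditions (no atom of mass above [1/m], positive mass of rational intervals,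
    no ties, one extension condition per pair of finite sets).  Near a measure
    without atoms the distribution functions converge uniformly, hence each
    condition holds in a neighbourhood of every point of [UTOURM], and [UTOURM]
    is the intersection of the interiors of the conditions.

    Density: [pw mu nu - 1/2] is an antisymmetric bilinear form on proper measures
    whose kernel contains the uniform measure.  The prescribed coordinates are
    first replaced by measures [b_n] with a step density, constant near [0], and
    the others by the uniform measure.  Inside [[0, h]] there are disjoint cells
    carrying signed step densities [e_r], [f_r] annihilating affine functions; they
    pair to zero with all [b_n] and with each other, except [e_r] with [f_r].
    Adding to [b_n] a small multiple of [e_n + sum_(m < n) c_nm f_m] shifts the
    form at [(n, m)] by a positive multiple of [c_nm], so the signs [c_nm = 1, -1]
    can be chosen to break all ties and to make every late vertex realize a
    prescribed extension. *)

(** * Measures with a density *)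

Section Density.
Context (R : realType) (d : R -> R).
Hypothesis md : measurable_fun [set: measurableTypeR R] d.
Hypothesis d_ge0 : forall x, 0 <= d x.
Hypothesis d_mass : (\int[lebesgue_measure]_x (d x)%:E = 1)%E.
Local Notation leb := (@lebesgue_measure R).
Local Open Scope ereal_scope.

Definition density_measure (A : set (measurableTypeR R)) : \bar R :=
  \int[leb]_(x in A) (d x)%:E.

Let density0 : density_measure set0 = 0.
Proof. by rewrite /density_measure integral_set0. Qed.

Let density_ge0 A : 0 <= density_measure A.
Proof. by apply: integral_ge0 => x _; rewrite lee_fin. Qed.

Let density_sigma_additive : semi_sigma_additive density_measure.
Proof.
apply: semi_sigma_additive_nng_induced; first exact/measurable_EFinP.
by move=> x; rewrite lee_fin.
Qed.

HB.instance Definition _ := isMeasure.Build _ _ _ density_measure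
  density0 density_ge0 density_sigma_additive.

HB.instance Definition _ := @Measure_isProbability.Build _ _ R
  density_measure d_mass.

Let density_dominates : density_measure `<< leb.
Proof.
apply/null_content_dominatesP => A mA A0.
apply: null_set_integral => //.
by apply: measurable_funTS; exact/measurable_EFinP.
Qed.

(** Pushing forward along the identity moves the measure from [measurableTypeR R] to [R], the type
    over which [probability R R] is stated. *)
Let id_borel : measurableTypeR R -> R := idfun.

#[local] HB.instance Definition _ :=
  @isMeasurableFun.Build _ _ _ _ id_borel (@measurable_id _ _ setT).

(** The change of variables is available for Radon-Nikodym derivatives. The derivative of
    [density_measure] agrees with [d] almost everywhere, since both have the same integral over
    every measurable set. *)
Lemma density_probability : exists P : probability R R,
  (forall A, P A = \int[leb]_(x in A) (d x)%:E) /\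
  (forall f A, measurable A -> P.-integrable A (EFin \o f) ->
    \int[P]_(x in A) (f x)%:E = \int[leb]_(x in A) (f x * d x)%:E).
Proof.
exists (distribution density_measure id_borel); split=> [//|f A mA intf].
(* Integrability gives measurability on [A] only; extending [f] by 0 outside [A] makes it measurable
   everywhere. *)
wlog mf : f intf / measurable_fun [set: R] f => [wlg|].
  have ff : {in A, (f \_ A)%R =1 f} by move=> x xA; rewrite patchE xA.
  transitivity (\int[distribution density_measure id_borel]_(x in A)
      ((f \_ A) x)%R%:E).
    by apply: eq_integral => x xA; rewrite ff.
  rewrite wlg.
  - by apply: eq_integral => x xA; rewrite ff.
  - by apply: eq_integrable intf => // x xA /=; rewrite ff.
  - apply/(measurable_restrictT _ mA); apply/measurable_EFinP.
    exact: (measurable_int _ intf).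
have mEf : measurable_fun [set: measurableTypeR R] (EFin \o f).
  exact/measurable_EFinP.
have intf_d : density_measure.-integrable A (EFin \o f).
  apply/integrableP; split; first exact: measurable_funTS.
  case/integrableP : intf => _; rewrite ge0_integral_pushforward//.
  by apply: measurableT_comp => //; exact: measurable_funTS mEf.
rewrite integral_pushforward//.
rewrite -(Radon_Nikodym_change_of_variables density_dominates)//.
set g := Radon_Nikodym _ _.
have g_int : leb.-integrable setT g by exact: Radon_Nikodym_integrable.
have : ae_eq leb A g (EFin \o d).
  apply: integral_ae_eq => //.
  - exact: integrableS g_int.
  - exact/measurable_funTS/measurable_EFinP.
  - by move=> E EA mE; rewrite -Radon_Nikodym_integral.
move=> gd; apply: ae_eq_integral => //.
- apply: emeasurable_funM; first exact: measurable_funTS.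
  by apply: measurable_funTS; exact: measurable_int g_int.
- by apply/measurable_EFinP/measurable_funM; exact: measurable_funTS.
- by apply: filterS gd => x /[apply] ->; rewrite EFinM.
Qed.

End Density.

(** Heine-Cantor, by the near-covering form of compactness: [good d] holds around each point for all
    small [d], hence on the whole segment for all small [d]. *)
Lemma within_continuous_uniform (R : realType) (a b : R) (f : R -> R) :
  {within `[a, b], continuous f} -> forall e, 0 < e ->
  exists2 d, 0 < d & forall x y, x \in `[a, b] -> y \in `[a, b] ->
    `|x - y| < d -> `|f x - f y| < e.
Proof.
move=> /subspace_continuousP cf e e0; have e20 : 0 < e / 2 by rewrite divr_gt0.
pose good (d x : R) := forall y, y \in `[a, b] -> `|x - y| < d -> `|f x - f y| < e.
have /compact_near_coveringP/near_covering_withinP cov := @segment_compact R a b.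
have : \forall d \near (0:R)^'+, `[a, b] `<=` good d.
  apply: cov => x0 abx0.
  have /cvgrPdist_lt/(_ _ e20) := cf _ abx0.
  rewrite near_withinE => /nbhs_ballP[r /= r0 xr]; have r20 : 0 < r / 2 by rewrite divr_gt0.
  exists (ball x0 (r / 2), [set d | d < r / 2]); first split.
  - exact: nbhsx_ballx.
  - exact: nbhs_right_lt.
  - move=> [x d] /= [x0x dr] abx y aby xy.
    have fx : `|f x0 - f x| < e / 2.
      by apply: xr => //; apply: le_ball x0x; lra.
    have fy : `|f x0 - f y| < e / 2.
      apply: xr => //; rewrite /ball /=.
      move: x0x; rewrite /ball /= => x0x.
      apply: le_lt_trans (ler_distD x _ _) _.
      by rewrite (splitr r) ltrD// (lt_trans xy).
    apply: le_lt_trans (ler_distD (f x0) _ _) _.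
    by rewrite (splitr e) ltrD// distrC.
move=> gd; have [d [d0 gdd]] := filter_ex (filterI (nbhs_right_gt (0 : R)) gd).
by exists d => // x y xab yab; exact: gdd.
Qed.

(** * Measures on the unit interval *)

Section UnitIntervalMeasures.
Context (R : realType).
Implicit Types (P Q : probability R R) (f g : R -> R) (x y : R).

Lemma measurable_I01 : measurable (I01 R : set R).
Proof. exact: measurable_itv. Qed.
#[local] Hint Resolve measurable_I01 : core.

Lemma I01P x : I01 R x <-> 0 <= x <= 1.
Proof. by rewrite /I01 /= in_itv. Qed.

Lemma bounded_integrable P f (C : R) : measurable_fun (I01 R) f ->
  (forall x, I01 R x -> `|f x| <= C) -> P.-integrable (I01 R) (EFin \o f).
Proof.
move=> mf fC; apply: measurable_bounded_integrable => //.
  by rewrite (le_lt_trans (probability_le1 _ _)) ?ltry.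
exists C; split; first exact: num_real.
by move=> r Cr x Ix /=; rewrite (le_trans (fC _ Ix)) ?ltW.
Qed.

Lemma continuous_measurable_I01 f :
  {within I01 R, continuous f} -> measurable_fun (I01 R) f.
Proof. exact: subspace_continuous_measurable_fun. Qed.

Lemma continuous_bounded_I01 f : {within I01 R, continuous f} ->
  exists2 C, 0 < C & forall x, I01 R x -> `|f x| <= C.
Proof.
move=> cf; have /compact_bounded[M [_ bM]] :=
  continuous_compact cf (@segment_compact R 0 1).
exists (`|M| + 1); first by rewrite ltr_wpDl.
move=> x Ix; apply: (bM (`|M| + 1)); last by exists x.
by rewrite (le_lt_trans (ler_norm M)) ?ltrDl.
Qed.

Lemma continuous_integrable P f : {within I01 R, continuous f} ->
  P.-integrable (I01 R) (EFin \o f).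
Proof.
move=> cf; have [C _ fC] := continuous_bounded_I01 cf.
exact: bounded_integrable (continuous_measurable_I01 cf) fC.
Qed.

Lemma test_intE P f : {within I01 R, continuous f} ->
  test_int P f = (\int[P]_(x in I01 R) f x)%:E.
Proof.
move=> cf; rewrite /test_int /Rintegral fineK//.
exact: integrable_fin_num (continuous_integrable P cf).
Qed.

Lemma on01_setC0 P : on01 P -> P (~` I01 R) = 0%E.
Proof. by rewrite /on01 => P1; rewrite probability_setC// P1 subee. Qed.

Lemma on01_setI P (A : set R) : on01 P -> measurable A ->
  (P (A `&` I01 R) = P A)%E.
Proof.
rewrite /on01 => P1 mA; have P0 : P (A `\` I01 R) = 0%E.
  apply: (@subset_measure0 _ _ _ P _ (~` I01 R)) => //.
  - exact: measurableD.
  - exact: measurableC.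
  - exact: on01_setC0.
by have := measureDI P mA measurable_I01; rewrite [X in (X + _)%E]P0 add0e.
Qed.

(** The half-line is open so that [lcdf Q x] is exactly the mass of the section at [x] of the set
    [p.2 < p.1] in [Udigraph]. *)
Definition lcdf P x : R := fine (P `]-oo, x[%classic).

Lemma lcdfE P x : P `]-oo, x[%classic = (lcdf P x)%:E.
Proof. by rewrite fineK// fin_num_measure. Qed.

Lemma lcdf_ge0 P x : 0 <= lcdf P x.
Proof. by rewrite fine_ge0. Qed.

Lemma lcdf_le1 P x : lcdf P x <= 1.
Proof. by rewrite -lee_fin -lcdfE probability_le1. Qed.

Lemma lcdf_le P x y : x <= y -> lcdf P x <= lcdf P y.
Proof.
move=> xy; rewrite -lee_fin -!lcdfE le_measure ?inE//.
by apply: subset_itvl; rewrite bnd_simp.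
Qed.

Lemma lcdfB P x y : x <= y -> P `[x, y[%classic = (lcdf P y - lcdf P x)%:E.
Proof.
move=> xy; rewrite EFinB -!lcdfE.
have -> : `]-oo, y[%classic = `]-oo, x[%classic `|` `[x, y[%classic :> set R.
  by rewrite (itv_bndbnd_setU (x := BLeft x)).
rewrite measureU//; last first.
  apply/seteqP; split => // z /=; rewrite !in_itv/= => -[zx /andP[xz _]].
  by move: zx; rewrite ltNge xz.
by rewrite addeAC subee ?add0e// fin_num_measure.
Qed.

Lemma lcdf_le0 P x : on01 P -> x <= 0 -> lcdf P x = 0.
Proof.
rewrite /on01 => P1 x0; rewrite /lcdf -(on01_setI P1)// [X in P X](_ : _ = set0) ?measure0//.
apply/seteqP; split => // z [/=]; rewrite in_itv/= => zx /I01P/andP[z0 _].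
by move: (lt_le_trans zx x0); rewrite ltNge z0.
Qed.

(** The inequality is strict because an atom at 1 is missed by the open half-line ending at 1. *)
Lemma lcdf_gt1 P x : on01 P -> 1 < x -> lcdf P x = 1.
Proof.
rewrite /on01 => P1 x1; rewrite /lcdf -(on01_setI P1)// setIidr ?P1//.
by move=> z /I01P/andP[_ z1]; rewrite /= in_itv/=; exact: le_lt_trans x1.
Qed.

Lemma measurable_lcdf P : measurable_fun setT (lcdf P).
Proof. by apply: nondecreasing_measurable => // x y; exact: lcdf_le. Qed.

Lemma lcdf_integrable P Q : P.-integrable (I01 R) (EFin \o lcdf Q).
Proof.
apply: (@bounded_integrable _ _ 1).
  by apply: measurable_funTS; exact: measurable_lcdf.
by move=> x _; rewrite ger0_norm ?lcdf_ge0 ?lcdf_le1.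
Qed.

Lemma on01_integral P f : on01 P -> measurable_fun setT f ->
  (forall x, 0 <= f x) ->
  (\int[P]_x (f x)%:E = \int[P]_(x in I01 R) (f x)%:E)%E.
Proof.
move=> P1 mf f0; have mf' : measurable_fun setT (EFin \o f) by exact/measurable_EFinP.
rewrite -(setUv (I01 R)) ge0_integral_setU//.
- rewrite [X in (_ + X)%E]null_set_integral ?adde0//.
  + exact: measurableC.
  + exact: measurable_funTS.
  + exact: on01_setC0.
- exact: measurableC.
- by rewrite setUv.
- by move=> x _; rewrite lee_fin.
- exact/disj_setPCl.
Qed.

Lemma product_measure_lcdf P Q : on01 P ->
  ((P \x Q)%E [set p : R * R | p.2 < p.1] =
  (\int[P]_(x in I01 R) lcdf Q x)%:E).
Proof.
move=> P1; rewrite /product_measure1 /=.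
transitivity (\int[P]_x (lcdf Q x)%:E)%E.
  apply: eq_integral => x _ /=; rewrite -lcdfE; congr (Q _).
  by apply/seteqP; split => y /=; rewrite /xsection/= inE/= in_itv.
rewrite on01_integral//; last 2 first.
- exact: measurable_lcdf.
- exact: lcdf_ge0.
by rewrite /Rintegral fineK// integrable_fin_num//; exact: lcdf_integrable.
Qed.

End UnitIntervalMeasures.

(** * Measures without atoms *)

Section Atomless.
Context (R : realType).
Implicit Types (P Q : probability R R) (f g : R -> R) (x y : R).
#[local] Hint Resolve measurable_I01 : core.

Definition atomless P := forall x, P [set x] = 0%E.

(** The windows [A n] decrease to the null set [{x}], so their masses tend to 0, and the mass of a
    window bounds the oscillation of [lcdf P] inside it. *)
Lemma lcdf_continuous P : atomless P -> continuous (lcdf P).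
Proof.
move=> P0; suff cts (x : R) : {for x, continuous (lcdf P)} by move=> x; exact: cts.
pose A n : set R := `]x - n.+1%:R^-1, x + n.+1%:R^-1[%classic.
have A_x : \bigcap_n A n = [set x].
  apply/seteqP; split=> [y Ay|_ -> n _]; last first.
    by rewrite /A /= in_itv/= gtrBl ltrDl invr_gt0 ltr0n.
  apply/eqP; apply: contraT => yx.
  have e0 : 0 < `|y - x| by rewrite normr_gt0 subr_eq0.
  have [n _ /(_ n (leqnn _))/= ne] := near_infty_natSinv_lt (PosNum e0).
  have := Ay n Logic.I; rewrite /A /= in_itv/= => /andP[xy xy'].
  move: xy xy' ne; set r := n.+1%:R^-1 => xy xy' ne.
  have : `|y - x| < r by rewrite ltr_norml; apply/andP; split; lra.
  by rewrite ltNge (ltW ne).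
have cA : P (A n) @[n --> \oo] --> (0 : \bar R)%E.
  rewrite -(P0 x) -A_x; apply: nonincreasing_cvg_mu.
  - by rewrite (le_lt_trans (probability_le1 P (measurable_itv _))) ?ltry.
  - by move=> n; exact: measurable_itv.
  - by rewrite A_x; exact: measurable_set1.
  - move=> m n mn; apply/subsetPset/subset_itv; rewrite bnd_simp.
    + by rewrite lerB// lef_pV2 ?posrE// ler_nat.
    + by rewrite lerD// lef_pV2 ?posrE// ler_nat.
suff near_x (e : R) : 0 < e -> exists2 r : R, 0 < r &
    forall y, `|x - y| < r -> `|lcdf P x - lcdf P y| < e.
  apply/cvgrPdist_lt => e e0; have [r r0 xr] := near_x e e0.
  by apply/nbhs_ballP; exists r.
move=> e0.
have [n _ /(_ n (leqnn _)) Pn] : \forall n \near \oo, (P (A n) < e%:E)%E.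
  apply: (cA [set y | (y < e%:E)%E]); apply: open_nbhs_nbhs; split => //.
  exact: open_ereal_lt_ereal.
have : 0 < n.+1%:R^-1 :> R by rewrite invr_gt0.
move: Pn; rewrite /A; set r := n.+1%:R^-1 => Pn r0.
set J : set R := `]x - r, x + r[%classic in Pn.
have sub (a b : R) : x - r < a -> a <= b -> b < x + r -> lcdf P b - lcdf P a < e.
  move=> xa ab bx; rewrite -lte_fin (le_lt_trans _ Pn)// -lcdfB//.
  rewrite le_measure ?inE//; [exact: measurable_itv..|].
  by apply: subset_itv; rewrite bnd_simp// ltW.
exists r => // y; rewrite ltr_norml => /andP[xy1 xy2].
have [yx|yx] := lerP y x.
  by rewrite ger0_norm ?subr_ge0 ?lcdf_le//; apply: sub => //; lra.
by rewrite distrC ger0_norm ?subr_ge0 ?lcdf_le ?ltW//; apply: sub; lra.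
Qed.

(** For [P] on the unit interval, the probability that a point drawn from [P] exceeds an independent
    point drawn from [Q]. *)
Definition pw P Q := \int[P]_(x in I01 R) lcdf Q x.

(** Both orders of integration give the same mass to [y < x]. The section at [y] has mass
    [1 - P(x <= y)], and the point [y] is null for [P], so this is [1 - lcdf P y]. *)
Lemma pwD P Q : on01 P -> on01 Q -> atomless P -> pw P Q + pw Q P = 1.
Proof.
move=> P1 Q1 P0; pose B : set (R * R) := [set p : R * R | p.2 < p.1].
have mB : measurable B.
  have -> : B = (fun p : R * R => p.1 - p.2) @^-1` `]0, +oo[%classic.
    by apply/seteqP; split => p /=; rewrite in_itv/= andbT subr_gt0.
  rewrite -[X in measurable X]setTI.
  have : measurable_fun [set: R * R] (fun p : R * R => p.1 - p.2).
    exact: measurable_funB measurable_fst measurable_snd.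
  by apply => //; exact: measurable_itv.
have : (P \x Q)%E B = (P \x^ Q)%E B.
  by apply: product_measure_unique => //= C D mC mD; exact: product_measure2E.
rewrite product_measure_lcdf// -/(pw P Q) /product_measure2.
rewrite (_ : integral _ _ _ = (1 - pw Q P)%:E).
  by move=> -[->]; rewrite subrK.
transitivity (\int[Q]_y (1 - (lcdf P y)%:E))%E.
  apply: eq_integral => y _; rewrite -lcdfE [LHS]/=.
  have -> : ysection B y = ~` (`]-oo, y[ `|` [set y])%classic.
    apply/seteqP; split => x /=; rewrite /ysection/= inE/= in_itv/=.
      rewrite /B /= => yx [xy|xy]; first by move: (lt_trans yx xy); rewrite ltxx.
      by move: yx; rewrite xy ltxx.
    move=> /not_orP[/negP xy /eqP xy']; by rewrite /B /= lt_neqAle eq_sym xy' /= leNgt.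
  rewrite probability_setC//; last exact: measurableU.
  rewrite measureU//; first by congr (_ - _)%E; rewrite [X in (_ + X)%E]P0 adde0.
  by apply/seteqP; split => // x [/=]; rewrite in_itv/= => /[swap] ->; rewrite ltxx.
have i1 : Q.-integrable (I01 R) (EFin \o cst 1).
  by apply: (@bounded_integrable _ _ _ 1) => // x _; rewrite normr1.
have iP : Q.-integrable (I01 R) (EFin \o lcdf P) by exact: lcdf_integrable.
transitivity (\int[Q]_y (1 - lcdf P y)%:E)%E; first by [].
rewrite on01_integral//; last 2 first.
- by apply: measurable_funB => //; exact: measurable_lcdf.
- by move=> y; rewrite subr_ge0 lcdf_le1.
have := RintegralB (@measurable_I01 R) i1 iP.
rewrite (Rintegral_cst Q (@measurable_I01 R) 1) mul1r (congr1 fine Q1) /= => <-.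
have iB : Q.-integrable (I01 R) (EFin \o (fun y => 1 - lcdf P y)).
  apply: (@bounded_integrable _ _ _ 1) => [|y _].
    by apply/measurable_funTS/measurable_funB => //; exact: measurable_lcdf.
  by rewrite ger0_norm ?subr_ge0 ?lcdf_le1// lerBlDr lerDl lcdf_ge0.
rewrite /Rintegral fineK//.
exact: (integrable_fin_num (@measurable_I01 R) iB).
Qed.

End Atomless.

(** * Relative neighbourhoods in the weak topology *)

Section Neighbourhoods.
Context (R : realType).
Implicit Types (mu nu : nat -> probability R R) (A B : set (nat -> probability R R)).

(** The conclusion of [rel_open] as a predicate of its own, so that neighbourhoods relative to
    [M_0^N] can be intersected and shrunk. *)
Definition near_seq mu A := exists k (idx : 'I_k -> nat) (fs : 'I_k -> R -> R) (eps : R),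
  nbhd_data fs eps /\ forall nu, in_M0seq nu -> basic_nbhd mu idx fs eps nu -> A nu.

Lemma near_seqS mu A B : (forall nu, in_M0seq nu -> A nu -> B nu) ->
  near_seq mu A -> near_seq mu B.
Proof.
move=> AB [k [idx [fs [eps [fe H]]]]]; exists k, idx, fs, eps; split => // nu M0 b.
by apply: AB => //; exact: H.
Qed.

Lemma near_seqT mu A : (forall nu, in_M0seq nu -> A nu) -> near_seq mu A.
Proof.
move=> HA; exists 0%N, (fun=> 0%N), (fun _ _ => 0), 1; split; last by move=> nu M0 _; exact: HA.
by split=> // -[].
Qed.

Lemma near_seqI mu A B : near_seq mu A -> near_seq mu B -> near_seq mu (A `&` B).
Proof.
move=> [k1 [idx1 [fs1 [e1 [[e10 c1] H1]]]]] [k2 [idx2 [fs2 [e2 [[e20 c2] H2]]]]].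
exists (k1 + k2)%N,
  (fun i => match fintype.split i with inl a => idx1 a | inr b => idx2 b end),
  (fun i => match fintype.split i with inl a => fs1 a | inr b => fs2 b end),
  (Num.min e1 e2); split.
  by split; [rewrite lt_min e10|move=> i; case: (fintype.split i)].
move=> nu M0 b; split.
- apply: H1 => // i; have := b (unsplit (inl i)); rewrite unsplitK => /lt_le_trans.
  by apply; rewrite lee_fin ge_min lexx.
- apply: H2 => // i; have := b (unsplit (inr i)); rewrite unsplitK => /lt_le_trans.
  by apply; rewrite lee_fin ge_min lexx orbT.
Qed.

Lemma near_seq_all (T : eqType) (s : seq T) mu (A : T -> set (nat -> probability R R)) :
  (forall t, t \in s -> near_seq mu (A t)) ->
  near_seq mu (fun nu => forall t, t \in s -> A t nu).
Proof.
elim: s => [_|t s IHs H]; first exact: near_seqT.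
have Ht : near_seq mu (A t) by apply: H; rewrite mem_head.
have /(near_seqI Ht) : near_seq mu (fun nu => forall t, t \in s -> A t nu).
  by apply: IHs => u us; apply: H; rewrite in_cons us orbT.
by apply: near_seqS => nu _ [tA sA] u; rewrite in_cons => /predU1P[->//|]; exact: sA.
Qed.

Lemma test_int_dist (P Q : probability R R) (f : R -> R) (e : R) :
  {within I01 R, continuous f} ->
  (`|test_int P f - test_int Q f| < e%:E)%E =
  (`|\int[P]_(x in I01 R) f x - \int[Q]_(x in I01 R) f x| < e).
Proof. by move=> cf; rewrite !test_intE. Qed.

Lemma near_seq1 mu n (f : R -> R) (e : R) : {within I01 R, continuous f} -> 0 < e ->
  near_seq mu (fun nu => `|\int[nu n]_(x in I01 R) f x - \int[mu n]_(x in I01 R) f x| < e).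
Proof.
move=> cf e0; exists 1%N, (fun=> n), (fun=> f), e; split; first by split.
by move=> nu _ /(_ ord0); rewrite test_int_dist.
Qed.

(** Keep the test functions and halve the radius: two steps of size [eps / 2] stay within [eps]. *)
Lemma near_seq_interior mu A : near_seq mu A -> near_seq mu (fun nu => near_seq nu A).
Proof.
move=> [k [idx [fs [eps [[e0 cf] H]]]]]; have e20 : 0 < eps / 2 by rewrite divr_gt0.
exists k, idx, fs, (eps / 2); split; first by [].
move=> nu _ numu; exists k, idx, fs, (eps / 2); split; first by [].
move=> xi xi0 xinu; apply: H => // i.
move: (numu i) (xinu i); rewrite !test_int_dist// => h1 h2.
apply: le_lt_trans (ler_distD (\int[nu (idx i)]_(x in I01 R) fs i x) _ _) _.
by rewrite (splitr eps) ltrD.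
Qed.

Definition interior_seq A : set (nat -> probability R R) := fun mu => near_seq mu A.

Lemma rel_open_interior A : rel_open (interior_seq A).
Proof. by move=> mu M0 /near_seq_interior. Qed.

Lemma interior_seq_sub A mu : in_M0seq mu -> interior_seq A mu -> A mu.
Proof.
move=> M0 [k [idx [fs [eps [[e0 cf] H]]]]]; apply: H => // i.
by rewrite test_intE// subee// abse0 lte_fin.
Qed.

(** The truncation [min(1, max(0, t))], in a form where continuity is immediate and bounds reduce to
    linear arithmetic by cases on signs. *)
Definition clamp (t : R) : R := (1 + `|t| - `|t - 1|) / 2.

Lemma clamp_ge0 t : 0 <= clamp t.
Proof. by rewrite /clamp; case: (ler0P t); case: (ler0P (t - 1)); lra. Qed.

Lemma clamp_le1 t : clamp t <= 1.
Proof. by rewrite /clamp; case: (ler0P t); case: (ler0P (t - 1)); lra. Qed.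

Lemma clamp_eq1 t : 1 <= t -> clamp t = 1.
Proof. by rewrite /clamp; case: (ler0P t); case: (ler0P (t - 1)); lra. Qed.

Lemma clamp_eq0 t : t <= 0 -> clamp t = 0.
Proof. by rewrite /clamp; case: (ler0P t); case: (ler0P (t - 1)); lra. Qed.

Lemma clamp_continuous : continuous clamp.
Proof.
suff cts (t : R) : {for t, continuous clamp} by move=> t; exact: cts.
apply: cvgM; last exact: cvg_cst.
apply: cvgB; first by apply: cvgD; [exact: cvg_cst|apply: cvg_norm; exact: cvg_id].
by apply: cvg_norm; apply: cvgB; [exact: cvg_id|exact: cvg_cst].
Qed.

(** For [M > 0] it is 1 up to [(k - 1) / M] and 0 from [k / M] on, so its integral lies between the
    values of [lcdf] at two neighbouring grid points. *)
Definition ramp_down (M k : R) (x : R) : R := clamp (k - M * x).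

Lemma ramp_down_continuous M k : {within I01 R, continuous (ramp_down M k)}.
Proof.
apply: continuous_subspaceT => x.
suff cts (t : R) : {for t, continuous (ramp_down M k)} by exact: cts.
apply: (@continuous_comp _ _ _ (fun x => k - M * x) clamp); last exact: clamp_continuous.
apply: cvgB; first exact: cvg_cst.
by apply: cvgM; [exact: cvg_cst|exact: cvg_id].
Qed.

Lemma lcdf_int (P : probability R R) a : on01 P ->
  lcdf P a = \int[P]_(x in I01 R) \1_(`]-oo, a[%classic : set R) x.
Proof.
move=> P1; rewrite /Rintegral integral_indic//; last exact: measurable_I01.
by rewrite /lcdf -(on01_setI P1).
Qed.

Lemma indic_integrable (P : probability R R) (a : R) :
  P.-integrable (I01 R) (EFin \o (\1_(`]-oo, a[%classic : set R) : R -> R)).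
Proof.
apply: (@bounded_integrable _ _ _ 1) => [|x _].
  by apply: measurable_funTS; apply: measurable_indic; exact: measurable_itv.
by rewrite indicE; case: (_ \in _); rewrite ?normr1 ?normr0.
Qed.

Lemma lcdf_le_int (P : probability R R) a (f : R -> R) : on01 P -> {within I01 R, continuous f} ->
  (forall x, I01 R x -> 0 <= f x) -> (forall x, x < a -> f x = 1) ->
  lcdf P a <= \int[P]_(x in I01 R) f x.
Proof.
move=> P1 cf f0 f1; rewrite lcdf_int//; apply: le_Rintegral.
- exact: measurable_I01.
- exact: indic_integrable.
- exact: continuous_integrable.
- move=> x Ix; rewrite indicE; case: (boolP (_ \in _)) => [|_]; last exact: f0.
  by rewrite inE/= in_itv/= => xa; rewrite f1.
Qed.

Lemma int_le_lcdf (P : probability R R) a (f : R -> R) : on01 P -> {within I01 R, continuous f} ->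
  (forall x, I01 R x -> f x <= 1) -> (forall x, a <= x -> f x = 0) ->
  \int[P]_(x in I01 R) f x <= lcdf P a.
Proof.
move=> P1 cf f0 f1; rewrite lcdf_int//; apply: le_Rintegral.
- exact: measurable_I01.
- exact: continuous_integrable.
- exact: indic_integrable.
- move=> x Ix; rewrite indicE; case: (boolP (_ \in _)) => [_|]; first exact: f0.
  by rewrite notin_setE/= in_itv/= => /negP; rewrite -leNgt => xa; rewrite f1.
Qed.

Lemma ramp_down_lower (P : probability R R) M k : 0 < M -> on01 P ->
  lcdf P ((k - 1) / M) <= \int[P]_(x in I01 R) ramp_down M k x.
Proof.
move=> M0 P1; apply: lcdf_le_int => //.
- exact: ramp_down_continuous.
- by move=> x _; exact: clamp_ge0.
- by move=> x; rewrite ltr_pdivlMr// mulrC => xk; apply: clamp_eq1; lra.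
Qed.

Lemma ramp_down_upper (P : probability R R) M k : 0 < M -> on01 P ->
  \int[P]_(x in I01 R) ramp_down M k x <= lcdf P (k / M).
Proof.
move=> M0 P1; apply: int_le_lcdf => //.
- exact: ramp_down_continuous.
- by move=> x _; exact: clamp_le1.
- by move=> x; rewrite ler_pdivrMr// mulrC => xk; apply: clamp_eq0; lra.
Qed.

(* Polya: weak convergence to a measure with continuous distribution function
   is uniform on distribution functions. *)
Lemma lcdf_near mu n (e : R) : (forall m, on01 (mu m)) -> atomless (mu n) -> 0 < e ->
  near_seq mu (fun nu => forall x, `|lcdf (nu n) x - lcdf (mu n) x| < e).
Proof.
move=> mu1 mu0 e0; have e40 : 0 < e / 4 by rewrite divr_gt0.
(* All grid points met below lie in this segment: they range between [(k - 1) / M >= -1] and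
   [(k + 2) / M <= 1 + 2 / M <= 3]. *)
have [d d0 dP] : exists2 d : R, 0 < d & forall x y, x \in `[-1, 3] -> y \in `[-1, 3] ->
    `|x - y| < d -> `|lcdf (mu n) x - lcdf (mu n) y| < e / 4.
  apply: within_continuous_uniform => //; apply: continuous_subspaceT.
  exact: lcdf_continuous.
pose N := (Num.truncn (3 / d)).+1; pose M : R := N%:R.
have M1 : 1 <= M by rewrite ler1n.
have M0 : 0 < M by rewrite (lt_le_trans ltr01).
have Md : 3 / M < d.
  by rewrite ltr_pdivrMr// mulrC -ltr_pdivrMr// truncnS_gt.
(* The ramps of index [k] and [k + 2] are used for [k <= N], hence the indices up to [N + 2]. *)
have := @near_seq_all _ (iota 0 N.+3) mu (fun k nu =>
  `|\int[nu n]_(x in I01 R) ramp_down M k%:R x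
    - \int[mu n]_(x in I01 R) ramp_down M k%:R x| < e / 4).
have H k : k \in iota 0 N.+3 -> near_seq mu (fun nu =>
    `|\int[nu n]_(x in I01 R) ramp_down M k%:R x
    - \int[mu n]_(x in I01 R) ramp_down M k%:R x| < e / 4).
  by move=> _; apply: near_seq1 => //; exact: ramp_down_continuous.
move/(_ H); apply: near_seqS => nu nuM0 nuP x {H}.
have nu1 : on01 (nu n) by have [] := nuM0 n.
have [x0|x0] := lerP x 0; first by rewrite !lcdf_le0// subrr normr0.
have [x1|x1] := ltrP 1 x; first by rewrite !lcdf_gt1// subrr normr0.
pose k := Num.truncn (M * x).
have /andP[kx xk] : k%:R <= M * x < k.+1%:R by apply: truncn_itv; nra.
have kN : (k <= N)%N.
  rewrite -(ler_nat R) (le_trans kx)//; rewrite -[leRHS]mulr1 ler_pM2l//.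
have osc (y : R) : x - 3 / M < y -> y < x + 3 / M -> -1 <= y -> y <= 3 ->
    `|lcdf (mu n) x - lcdf (mu n) y| < e / 4.
  move=> xy yx y1 y3; apply: dP; rewrite ?in_itv/=; [lra..|].
  by rewrite ltr_norml; apply/andP; split; lra.
have Mi : 0 < M^-1 by rewrite invr_gt0.
have Mi1 : M^-1 <= 1 by rewrite invf_le1.
have xE : x = (M * x) * M^-1 by rewrite mulrAC divff ?mul1r// gt_eqF.
have kM := ler_wpM2r (ltW Mi) kx.
have Mk : M * x * M^-1 < k.+1%:R * M^-1 by rewrite ltr_pM2r.
rewrite -xE in kM Mk; rewrite -natr1 mulrDl mul1r in Mk.
have k0 : 0 <= k%:R * M^-1 by rewrite mulr_ge0// ltW.
have kiota j : (j <= 2)%N -> (k + j)%N \in iota 0 N.+3.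
  by move=> j2; rewrite mem_iota add0n ltnS -addn2 leq_add.
(* The ramp of index [k + 2] is 1 to the left of [(k + 1) / M], which exceeds [x]. Passing from
   [nu n] to [mu n] costs [e / 4], and so does returning from [(k + 2) / M] to [x]. *)
have up : lcdf (nu n) x < lcdf (mu n) x + e / 2.
  have := nuP _ (kiota 2%N isT); rewrite natrD ltr_norml => /andP[_ h].
  have h1 := ramp_down_lower (k%:R + 2) M0 nu1.
  have h2 := ramp_down_upper (k%:R + 2) M0 (mu1 n).
  have h3 : lcdf (nu n) x <= lcdf (nu n) ((k%:R + 2 - 1) / M).
    by apply: lcdf_le; rewrite mulrBl mulrDl mul1r; lra.
  have h4 : `|lcdf (mu n) x - lcdf (mu n) ((k%:R + 2) / M)| < e / 4.
    by apply: osc; rewrite mulrDl; lra.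
  by move: h4; rewrite ltr_norml => /andP[h5 _]; lra.
(* Symmetrically, the ramp of index [k] vanishes from [k / M <= x] on and is 1 to the left of
   [(k - 1) / M]. *)
have dn : lcdf (mu n) x - e / 2 < lcdf (nu n) x.
  have := nuP _ (kiota 0%N isT); rewrite addn0 ltr_norml => /andP[h _].
  have h1 := ramp_down_lower k%:R M0 (mu1 n).
  have h2 := ramp_down_upper k%:R M0 nu1.
  have h3 : lcdf (nu n) (k%:R / M) <= lcdf (nu n) x by apply: lcdf_le.
  have h4 : `|lcdf (mu n) x - lcdf (mu n) ((k%:R - 1) / M)| < e / 4.
    by apply: osc; rewrite mulrBl mul1r; lra.
  by move: h4; rewrite ltr_norml => /andP[_ h5]; lra.
by rewrite ltr_norml; apply/andP; split; lra.
Qed.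

End Neighbourhoods.

(** * Universal tournaments *)

Section ExtensionProperty.

Definition ext_property (U : nat -> nat -> Prop) := forall A B : seq nat,
  (forall x, x \in A -> x \notin B) ->
  exists v, [/\ v \notin A, v \notin B, forall a, a \in A -> U v a &
    forall b, b \in B -> U b v].

(** Adjoin a vertex [None] to [U] that beats exactly [A], and extend the identity embedding of
    [A ++ B]; the image of [None] is the required vertex. Vertices outside [A] and [B] also beat
    [None], which keeps the enlarged digraph a tournament. *)
Lemma universal_ext U : universal_tournament U -> ext_property U.
Proof.
move=> [[Uirr Utot] Uuniv] A B AB.
pose E (s t : option nat) : Prop := match s, t with
  | Some i, Some j => U i j
  | None, Some a => a \in A
  | Some b, None => b \notin A
  | None, None => False
  end.
have tE : is_tournament E.
  split=> [[i|]//|[i|] [j|] ij //=]; first exact: Uirr.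
  - by apply: Utot => ij'; apply: ij; rewrite ij'.
  - split; last by case=> /negP.
    by case: (boolP (i \in A)); [right|left].
  - split; last by case=> jA /negP.
    by case: (boolP (j \in A)); [left|right].
pose S0 : set (option nat) := Some @` [set` A ++ B].
have [|||psi [[psi_inj psiE] psi0]] :=
  Uuniv (option nat) E S0 (odflt 0%N) _ tE.
- exact: countableP.
- exact/finite_image/finite_seq.
- by split=> _ _ [i _ <-] [j _ <-] //= ->.
have psiS i : i \in A ++ B -> psi (Some i) = i.
  by move=> iAB; rewrite psi0//; exists i.
have psiA i : i \in A -> psi (Some i) = i.
  by move=> iA; rewrite psiS// mem_cat iA.
have psiB i : i \in B -> psi (Some i) = i.
  by move=> iB; rewrite psiS// mem_cat iB orbT.
exists (psi None); split.
- by apply/negP => vA; have /(psi_inj _ _ Logic.I Logic.I) := psiA _ vA.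
- by apply/negP => vB; have /(psi_inj _ _ Logic.I Logic.I) := psiB _ vB.
- by move=> a aA; rewrite -(psiA a aA); apply/psiE.
- move=> b bB; rewrite -[X in U X _](psiB b bB); apply/psiE => //=.
  by apply/negP => bA; have := AB _ bA; rewrite bB.
Qed.

(** Apply the extension property to the images [A] and [B] of the out- and in-neighbours of [s] in
    [D], and send [s] to the vertex obtained. *)
Lemma ext_step (S : Type) (E : S -> S -> Prop) (U : nat -> nat -> Prop)
    (D : set S) (s : S) (phi : S -> nat) :
  is_tournament E -> is_tournament U -> ext_property U ->
  finite_set D -> embedding_on D E U phi ->
  exists psi, embedding_on (D `|` [set s]) E U psi /\
    forall t, D t -> psi t = phi t.
Proof.
move=> [Eirr Etot] [Uirr Utot] extU finD [phi_inj phiE].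
have [Ds|nDs] := pselect (D s).
  by exists phi; split => //; rewrite (_ : D `|` _ = D)//; apply/setUidl => _ ->.
have [A AE] : exists A : seq nat, phi @` (D `&` E s) = [set` A].
  by apply/finite_seqP/finite_image; exact: finite_setIl.
have [B BE] : exists B : seq nat, phi @` (D `&` E^~ s) = [set` B].
  by apply/finite_seqP/finite_image; exact: finite_setIl.
have [x|v [vA vB Uva Ubv]] := extU A B.
  move=> xA; apply/negP => xB.
  have [a [Da Ea] ax] : (phi @` (D `&` E s)) x by rewrite AE.
  have [b [Db Eb] bx] : (phi @` (D `&` E^~ s)) x by rewrite BE.
  have ab : a = b by apply: phi_inj => //; rewrite ax.
  have sa : s <> a by move=> sa; apply: nDs; rewrite sa.
  by have [_] := Etot _ _ sa; apply; split => //; rewrite ab.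
have inA t : D t -> E s t -> phi t \in A.
  by move=> Dt Est; have : (phi @` (D `&` E s)) (phi t) by [exists t]; rewrite AE.
have inB t : D t -> E t s -> phi t \in B.
  by move=> Dt Est; have : (phi @` (D `&` E^~ s)) (phi t) by [exists t]; rewrite BE.
have ne t : D t -> t <> s by move=> Dt ts; apply: nDs; rewrite -ts.
have phi_v t : D t -> phi t <> v.
  move=> Dt tv; have [[Est|Ets] _] := Etot _ _ (nesym (ne t Dt)).
    by have := inA _ Dt Est; rewrite tv (negbTE vA).
  by have := inB _ Dt Ets; rewrite tv (negbTE vB).
pose psi t := if pselect (t = s) is left _ then v else phi t.
have psis : psi s = v by rewrite /psi; case: pselect.
have psiD t : D t -> psi t = phi t.
  by move=> Dt; rewrite /psi; case: pselect => // /(ne _ Dt).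
have Uasym i j : U i j -> ~ U j i.
  move=> Uij Uji; have [ij|ij] := pselect (i = j).
    by apply: (Uirr i); move: Uij; rewrite -ij.
  by have [_] := Utot _ _ ij; apply.
exists psi; split => //; split.
- move=> i j [Di|->] [Dj|->]; rewrite ?psis ?psiD//.
  + exact: phi_inj.
  + by move=> /phi_v.
  + by move=> /esym/phi_v.
- move=> i j [Di|->] [Dj|->]; rewrite ?psis ?psiD//.
  + exact: phiE.
  + split=> [Eis|Uiv]; first exact/Ubv/inB.
    have [[//|Esi] _] := Etot _ _ (ne i Di).
    by case: (Uasym _ _ Uiv); exact/Uva/inA.
  + split=> [Esj|Uvj]; first exact/Uva/inA.
    have [[Ejs|//] _] := Etot _ _ (ne j Dj).
    by case: (Uasym _ _ Uvj); exact/Ubv/inB.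
  + by split=> [/Eirr|/Uirr].
Qed.

(** Enumerate [S] by an injection [g] into [nat], add the points one at a time to [S0] by
    [ext_step], and glue the resulting coherent embeddings. *)
Lemma ext_universal U : is_tournament U -> ext_property U -> universal_tournament U.
Proof.
move=> tU extU; split => // S E S0 phi cS tE finS0 phiE.
have [g g_inj] : exists g : S -> nat, injective g.
  have /countable_injP[g g_inj] := cS.
  by exists g => x y; apply: g_inj; rewrite inE.
pose D n := S0 `|` [set s | (g s < n)%N].
have finD n : finite_set (D n).
  rewrite finite_setU; split => //.
  apply: (@finite_preimage _ _ `I_n g); last exact: finite_II.
  by move=> x y _ _; exact: g_inj.
have stepD n s : g s = n -> D n.+1 = D n `|` [set s].
  move=> gs; rewrite /D -setUA; congr (_ `|` _).
  apply/seteqP; split => t /=; rewrite ltnS.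
    by rewrite leq_eqVlt => /orP[/eqP gt|]; [right; apply: g_inj; rewrite gt|left].
  by move=> [/ltnW//|->]; rewrite gs.
(* The embedding hypothesis sits inside the existential so that [choice] yields a total step
   function. If no point has code [n], the domain does not change. *)
have ex_step (p : nat * (S -> nat)) : exists psi,
    embedding_on (D p.1) E U p.2 -> embedding_on (D p.1.+1) E U psi /\
    forall t, D p.1 t -> psi t = p.2 t.
  case: p => n f /=.
  have [emb|] := pselect (embedding_on (D n) E U f); last by exists f.
  have [[s gs]|ngs] := pselect (exists s, g s = n).
    rewrite (stepD n s gs).
    by have [psi psiP] := @ext_step _ _ _ _ s _ tE tU extU (finD n) emb; exists psi.
  exists f; split => //; rewrite (_ : D n.+1 = D n)//.
  apply/seteqP; split => t [|/=]; try by left.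
    rewrite ltnS leq_eqVlt => /orP[/eqP gt|]; last by right.
    by case: ngs; exists t.
  by move=> gt; right; rewrite /= ltnS ltnW.
have [F FP] := choice ex_step.
pose psi := fix psi n := if n is m.+1 then F (m, psi m) else phi.
have psiE n : embedding_on (D n) E U (psi n).
  elim: n => [|n IHn]; last by have [] := FP (n, psi n) IHn.
  rewrite (_ : D 0%N = S0)//; apply/seteqP; split => t; last by left.
  by case.
have psiS n t : D n t -> psi n.+1 t = psi n t.
  by move=> Dt; have [_ h] := FP (n, psi n) (psiE n); exact: h.
have Dmono m n t : (m <= n)%N -> D m t -> D n t.
  by move=> mn [S0t|/= gt]; [left|right; exact: leq_trans mn].
have psi_stable m n t : (m <= n)%N -> D m t -> psi n t = psi m t.
  move=> /subnK <- Dt; elim: (n - m)%N => // k IHk.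
  by rewrite addSn psiS//; apply: Dmono Dt; exact: leq_addl.
(* Stage [g t + 1] is one at which [t] is certain to be in the domain; later stages keep its
   value. *)
pose Psi t := psi (g t).+1 t.
have PsiE n t : (g t < n)%N -> Psi t = psi n t.
  by move=> gt; rewrite (psi_stable (g t).+1 n)//; right => /=.
exists Psi; split; last first.
  by move=> t S0t; rewrite /Psi (psi_stable 0%N)//; left.
split=> i j _ _.
  pose n := (maxn (g i) (g j)).+1.
  rewrite (PsiE n) ?ltnS ?leq_maxl// (PsiE n j) ?ltnS ?leq_maxr//.
  by apply: (psiE n).1; right; rewrite /= ltnS ?leq_maxl ?leq_maxr.
pose n := (maxn (g i) (g j)).+1.
rewrite (PsiE n) ?ltnS ?leq_maxl// (PsiE n j) ?ltnS ?leq_maxr//.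
by apply: (psiE n).2; right; rewrite /= ltnS ?leq_maxl ?leq_maxr.
Qed.

End ExtensionProperty.

(** * The G_delta property *)

Section GDelta.
Context (R : realType).
Implicit Types (mu nu : nat -> probability R R).

Lemma M0seq_on01 mu : in_M0seq mu -> forall n, on01 (mu n).
Proof. by move=> M0 n; have [] := M0 n. Qed.

Lemma UdigraphE mu i j : (forall n, on01 (mu n)) ->
  Udigraph mu i j <-> i <> j /\ 2^-1 < pw (mu i) (mu j).
Proof. by move=> mu1; rewrite /Udigraph product_measure_lcdf// lte_fin. Qed.

Lemma Udigraph_tournament mu : in_M0seq mu -> (forall n, atomless (mu n)) ->
  (forall i j, i <> j -> Udigraph mu i j \/ Udigraph mu j i) ->
  is_tournament (Udigraph mu).
Proof.
move=> /M0seq_on01 mu1 mu0 Utot; split=> [i [//]|i j ij]; split; first exact: Utot.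
move=> [/(UdigraphE _ _ mu1)[_ h1] /(UdigraphE _ _ mu1)[_ h2]].
by have := pwD (mu1 i) (mu1 j) (mu0 i); lra.
Qed.

(** Write the excess over 1/2 as [2 * e]. Replacing [mu i] by [nu i] against the continuous function
    [lcdf (mu j)] loses less than [e], and replacing [lcdf (mu j)] by [lcdf (nu j)], uniformly
    close, loses at most [e]. *)
Lemma Udigraph_near mu i j : in_M0seq mu -> atomless (mu j) -> Udigraph mu i j ->
  near_seq mu (fun nu => Udigraph nu i j).
Proof.
move=> /M0seq_on01 mu1 muj0 /(UdigraphE _ _ mu1)[ij].
set p := pw _ _ => p2; pose e := (p - 2^-1) / 2.
have e0 : 0 < e by rewrite /e; lra.
have cl : {within I01 R, continuous (lcdf (mu j))}.
  by apply: continuous_subspaceT; exact: lcdf_continuous.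
have := near_seqI (near_seq1 mu i cl e0) (lcdf_near mu1 muj0 e0).
apply: near_seqS => nu /M0seq_on01 nu1 [h1 h2].
apply/UdigraphE => //; split => //.
have il := lcdf_integrable (nu i) (mu j).
have ic : (nu i).-integrable (I01 R) (EFin \o cst e).
  apply: (@bounded_integrable _ _ _ e) => [|x _]; first exact: measurable_cst.
  by rewrite /= ger0_norm// ltW.
have : \int[nu i]_(x in I01 R) (lcdf (mu j) x - cst e x) <= pw (nu i) (nu j).
  apply: le_Rintegral.
  - exact: measurable_I01.
  - exact: (integrableB (@measurable_I01 R) il ic).
  - exact: lcdf_integrable.
  - by move=> x _; have := h2 x; rewrite ltr_norml /= => /andP[h _]; lra.
rewrite (RintegralB (@measurable_I01 R) il ic).
rewrite (Rintegral_cst (nu i) (@measurable_I01 R) e) (congr1 fine (nu1 i)) /= mulr1.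
move: h1; rewrite ltr_norml => /andP[h _]; rewrite /e in h *.
by rewrite -/(pw (mu i) (mu j)) -/p in h; lra.
Qed.

(** Built from countable types only, so that [unpickle] enumerates all conditions. *)
Definition condition : Type :=
  ((nat * nat) + (nat * (rat * rat)) + (nat * nat) + (seq nat * seq nat))%type.

(* The four kinds of conditions express, in this order: no atoms, full support,
   no ties, and the extension property. *)
Definition satisfies mu (c : condition) : Prop :=
  match c with
  | inl (inl (inl (n, m))) => forall x, (mu n [set x] <= (m.+1%:R^-1)%:E)%E
  | inl (inl (inr (n, (p, q)))) =>
      (exists2 x : R, ratr p < x < ratr q & I01 R x) ->
      (0 < mu n `]ratr p, ratr q[%classic)%E
  | inl (inr (i, j)) => i <> j -> Udigraph mu i j \/ Udigraph mu j i
  | inr (A, B) => (forall x, x \in A -> x \notin B) ->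
      exists v, [/\ v \notin A, v \notin B, forall a, a \in A -> Udigraph mu v a &
        forall b, b \in B -> Udigraph mu b v]
  end.

Lemma satisfies_UTOURM mu : in_M0seq mu -> (forall c, satisfies mu c) -> UTOURM mu.
Proof.
move=> M0 H; have mu1 := M0seq_on01 M0.
have mu0 n : atomless (mu n).
  move=> x; apply/eqP; rewrite eq_le measure_ge0 andbT.
  apply/lee_addgt0Pr => e e0; rewrite add0e.
  have [m _ /(_ m (leqnn _)) me] := near_infty_natSinv_lt (PosNum e0).
  apply: le_trans (H (inl (inl (inl (n, m)))) x) _.
  by rewrite lee_fin ltW.
split.
  move=> n; split; first exact: M0.
  split; [exact: mu0|move=> U oU [x [Ux Ix]]].
  have /nbhs_ballP[r /= r0 xr] : nbhs x U by exact: open_nbhs_nbhs.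
  have [p /[!in_itv]/= /andP[xp px]] : exists p, ratr p \in `](x - r), x[.
    by apply: rat_in_itvoo; lra.
  have [q /[!in_itv]/= /andP[xq qx]] : exists q, ratr q \in `]x, (x + r)[.
    by apply: rat_in_itvoo; lra.
  have := H (inl (inl (inr (n, (p, q))))) => /(_ _)/lt_le_trans; apply.
    by exists x => //; rewrite px.
  rewrite -(on01_setI (mu1 n)); last exact: measurable_itv.
  apply: le_measure; rewrite ?inE.
  - by apply: measurableI; [exact: measurable_itv|exact: measurable_I01].
  - by apply: measurableI; [exact: open_measurable|exact: measurable_I01].
  - apply: setSI => y /=; rewrite in_itv/= => /andP[py yq]; apply: xr.
    by rewrite /ball/= ltr_norml; apply/andP; split; lra.
have tU : is_tournament (Udigraph mu).
  by apply: Udigraph_tournament => // i j ij; exact: (H (inl (inr (i, j)))).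
by apply: ext_universal => // A B; exact: (H (inr (A, B))).
Qed.

Lemma satisfies_near mu c : UTOURM mu -> near_seq mu (fun nu => satisfies nu c).
Proof.
move=> [mucont Uuniv]; have M0 : in_M0seq mu by move=> n; have [] := mucont n.
have mu1 := M0seq_on01 M0.
have mu0 n : atomless (mu n) by have [_ []] := mucont n.
have extU := universal_ext Uuniv; have [[_ Utot] _] := Uuniv.
case: c => [[[[n m]|[n [p q]]]|[i j]]|[A B]] /=.
(* The atom at [x] is covered by some [[x, y[] of [mu n]-mass below [e]; moving the two values of
   [lcdf] by less than [e] each leaves the mass below [3 * e]. *)
- pose e : R := m.+1%:R^-1 / 3.
  have e0 : 0 < e by rewrite divr_gt0// invr_gt0.
  have := lcdf_near mu1 (mu0 n) e0; apply: near_seqS => nu nuM0 nue x.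
  have [y xy ye] : exists2 y, x < y & lcdf (mu n) y - lcdf (mu n) x < e.
    have /cvgrPdist_lt/(_ _ e0)/nbhs_ballP[r /= r0 xr] := lcdf_continuous (mu0 n) (x := x).
    exists (x + r / 2); first by rewrite ltrDl divr_gt0.
    have : `|lcdf (mu n) x - lcdf (mu n) (x + r / 2)| < e.
      apply: xr; rewrite /ball/= opprD addrA subrr add0r normrN ger0_norm; lra.
    by rewrite distrC; exact: le_lt_trans (ler_norm _).
  apply: (@le_trans _ _ (nu n `[x, y[%classic)).
    apply: le_measure; rewrite ?inE; [exact: measurable_set1|exact: measurable_itv|].
    by move=> _ ->; rewrite /= in_itv/= lexx.
  rewrite (lcdfB _ (ltW xy)) lee_fin.
  have := nue x; have := nue y; rewrite !ltr_norml => /andP[_ h1] /andP[h2 _].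
  have -> : m.+1%:R^-1 = 3 * e by rewrite /e mulrC divfK ?pnatr_eq0.
  lra.
- have [[x /andP[px xq] Ix]|no] := pselect (exists2 x : R, ratr p < x < ratr q & I01 R x);
    last by apply: near_seqT.
  (* Passing to [[p1, q[] inside []p, q[] gives a mass [d > 0] that is a difference of values of
     [lcdf]; moving each value by less than [d / 3] keeps it positive. *)
  pose p1 := (ratr p + x) / 2; pose d := lcdf (mu n) (ratr q) - lcdf (mu n) p1.
  have pp1 : ratr p < p1 by rewrite /p1; lra.
  have p1x : p1 < x by rewrite /p1; lra.
  have d0 : 0 < d.
    rewrite -lte_fin -lcdfB; last by lra.
    have [_ [_ supp]] := mucont n.
    apply: lt_le_trans (supp `]p1, ratr q[%classic _ _) _.
    + exact: interval_open.
    + by exists x; split => //=; rewrite in_itv/= p1x.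
    + rewrite (on01_setI (mu1 n) (measurable_itv _)).
      apply: le_measure; rewrite ?inE; [exact: measurable_itv..|].
      by apply: subset_itv; rewrite bnd_simp.
  have d30 : 0 < d / 3 by rewrite divr_gt0.
  have := lcdf_near mu1 (mu0 n) d30; apply: near_seqS => nu nuM0 nue _.
  apply: (@lt_le_trans _ _ (nu n `[p1, ratr q[%classic)).
    rewrite lcdfB; last by lra.
    have := nue (ratr q); have := nue p1.
    have dE : d = lcdf (mu n) (ratr q) - lcdf (mu n) p1 by [].
    by rewrite lte_fin !ltr_norml => /andP[_ h1] /andP[h2 _]; lra.
  apply: le_measure; rewrite ?inE; [exact: measurable_itv..|].
  by apply: subset_itv; rewrite bnd_simp.
- have [->|ij] := pselect (i = j); first by apply: near_seqT => nu _ [].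
  have [[Uij|Uji] _] := Utot _ _ ij.
    by have := Udigraph_near M0 (mu0 j) Uij; apply: near_seqS => nu _ h _; left.
  by have := Udigraph_near M0 (mu0 i) Uji; apply: near_seqS => nu _ h _; right.
- have [AB|nAB] := pselect (forall x, x \in A -> x \notin B); last by apply: near_seqT.
  have [v [vA vB Uva Ubv]] := extU A B AB.
  have nA : near_seq mu (fun nu => forall a, a \in A -> Udigraph nu v a).
    by apply: near_seq_all => a /Uva; exact: Udigraph_near.
  have nB : near_seq mu (fun nu => forall b, b \in B -> Udigraph nu b v).
    by apply: near_seq_all => b /Ubv; exact: Udigraph_near.
  by have := near_seqI nA nB; apply: near_seqS => nu _ [hA hB] _; exists v.
Qed.

Lemma UTOURM_Gdelta : rel_Gdelta (@UTOURM R).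
Proof.
split=> [mu [mucont _] n|]; first by have [] := mucont n.
(* Conditions with a non-strict inequality need not be open, hence the interiors. A number coding no
   condition contributes the whole space. *)
pose G n := if unpickle n is Some c then
  interior_seq (fun nu => satisfies nu (c : condition)) else setT.
exists G; split=> [n|mu].
  rewrite /G; case: unpickle => [c|]; first exact: rel_open_interior.
  by move=> mu _ _; exact: near_seqT.
split=> [Umu|[M0 Gmu]].
  split=> [n|n]; first by have [/(_ n)[]] := Umu.
  by rewrite /G; case: unpickle => [c|//]; exact: satisfies_near.
apply: satisfies_UTOURM => // c.
by have := Gmu (pickle c); rewrite /G pickleK; exact: interior_seq_sub.
Qed.

End GDelta.

(** * Step densities *)

Section LebesgueIntegrals.
Context (R : realType).
Local Notation leb := (@lebesgue_measure R).
Implicit Types (a b t x : R) (f F : R -> R).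

(** The positive part of [t]; [half_sq] below is its primitive. *)
Definition ramp t : R := (t + `|t|) / 2.
Definition half_sq t : R := ramp t ^+ 2 / 2.

Lemma ramp_ge0 t : 0 <= t -> ramp t = t.
Proof. by move=> t0; rewrite /ramp ger0_norm//; lra. Qed.

Lemma ramp_le0 t : t <= 0 -> ramp t = 0.
Proof. by move=> t0; rewrite /ramp ler0_norm//; lra. Qed.

Lemma ramp_continuous t : continuous (fun x => ramp (x - t)).
Proof.
suff cts x : {for x, continuous (fun x => ramp (x - t))} by move=> x; exact: cts.
apply: cvgM; last exact: cvg_cst.
have c : {for x, continuous (fun x => x - t)} by apply: cvgB; [exact: cvg_id|exact: cvg_cst].
by apply: cvgD; [exact: c|exact: cvg_norm c].
Qed.

Lemma int_linear a b t : a <= b ->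
  \int[leb]_(x in `[a, b]) (x - t) = (b - t) ^+ 2 / 2 - (a - t) ^+ 2 / 2.
Proof.
rewrite le_eqVlt => /predU1P[->|ab]; first by rewrite set_itv1 Rintegral_set1 subrr.
pose F x := (x - t) ^+ 2 / 2.
have dF x : is_derive x (1 : R) F (x - t).
  rewrite /F; apply: is_derive_eq; rewrite /GRing.scale/=; lra.
have cF : continuous F.
  by move=> x; apply/differentiable_continuous/derivable1_diffP; have [] := dF x.
rewrite /Rintegral (@continuous_FTC2 _ (fun x => x - t) F)//.
- apply: continuous_subspaceT => x.
  by apply: cvgB; [exact: cvg_id|exact: cvg_cst].
- split; first by move=> x _; have [] := dF x.
  + by apply: cvg_at_right_filter; exact: cF.
  + by apply: cvg_at_left_filter; exact: cF.
- by move=> x _; rewrite derive1E; have := dF x => ?; rewrite derive_val.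
Qed.

Lemma continuous_integrable_itv a b f : continuous f ->
  leb.-integrable `[a, b] (EFin \o f).
Proof.
move=> cf; apply: continuous_compact_integrable; first exact: segment_compact.
exact: continuous_subspaceT.
Qed.

Lemma int_ramp a b t : a <= b ->
  \int[leb]_(x in `[a, b]) ramp (x - t) = half_sq (b - t) - half_sq (a - t).
Proof.
move=> ab; rewrite /half_sq.
have right_t a' : t <= a' -> a' <= b ->
    \int[leb]_(x in `[a', b]) ramp (x - t) = ramp (b - t) ^+ 2 / 2 - ramp (a' - t) ^+ 2 / 2.
  move=> ta ab'; rewrite !ramp_ge0; [|lra..].
  rewrite -int_linear//; apply: eq_Rintegral => x; rewrite inE/= in_itv/= => /andP[ax _].
  by rewrite ramp_ge0//; lra.
have left_t b' : b' <= t -> a <= b' -> \int[leb]_(x in `[a, b']) ramp (x - t) = 0.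
  move=> bt ab'; rewrite (@eq_Rintegral _ _ _ leb _ (cst 0)).
    by rewrite Rintegral_cst ?mul0r//; exact: measurable_itv.
  by move=> x; rewrite inE/= in_itv/= => /andP[_ xb]; rewrite ramp_le0//=; lra.
have [ta|at_] := lerP t a; first exact: right_t.
rewrite (ramp_le0 (t := a - t)); last lra.
have [bt|tb] := lerP b t; first by rewrite left_t// ramp_le0; lra.
have ir u v : leb.-integrable `[u, v] (EFin \o (fun x => ramp (x - t))).
  exact/continuous_integrable_itv/ramp_continuous.
have := @Rintegral_itvB _ (fun x => ramp (x - t)) (BLeft a) (BRight b) t (ir a b).
rewrite !bnd_simp => /(_ (ltW at_) (ltW tb)).
rewrite (left_t t (lexx t) (ltW at_)) subr0 => ->.
rewrite Rintegral_itv_obnd_cbnd; last first.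
  by apply: integrableS (ir t b); [exact: measurable_itv..|exact: subset_itv_oc_cc].
by rewrite (right_t t (lexx t) (ltW tb)) subrr (ramp_le0 (lexx 0)).
Qed.

Lemma int_below a b x : a <= b ->
  \int[leb]_(y in `[a, b]) \1_(`]-oo, x[%classic : set R) y = ramp (x - a) - ramp (x - b).
Proof.
move=> ab; rewrite /Rintegral integral_indic; [|exact: measurable_itv..].
have [xa|ax] := lerP x a.
  rewrite !ramp_le0; [|lra..].
  rewrite (_ : _ `&` _ = set0) ?measure0 ?subrr//.
  by apply/seteqP; split => // y [/=]; rewrite !in_itv/= => yx /andP[ay _]; lra.
rewrite (ramp_ge0 (t := x - a)); last lra.
have [xb|bx] := lerP x b.
  rewrite ramp_le0 ?subr0; last lra.
  rewrite (_ : _ `&` _ = `[a, x[%classic).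
    have := lebesgue_measure_itv (`[a, x[ : interval R).
    by rewrite /= lte_fin ax => /(congr1 fine).
  apply/seteqP; split => y /=; rewrite !in_itv/=.
    by move=> [yx /andP[ay _]]; rewrite ay.
  by move=> /andP[ay yx]; rewrite yx ay; split => //=; lra.
rewrite ramp_ge0; last lra.
rewrite (_ : _ `&` _ = `[a, b]%classic).
  have := lebesgue_measure_itv (`[a, b] : interval R).
  rewrite /= lte_fin; have [ab'|ba] := ltrP a b.
    by move=> /(congr1 fine) /= ->; lra.
  by move=> /(congr1 fine) /= ->; lra.
apply/seteqP; split => y /=; rewrite !in_itv/=; first by case.
by move=> /andP[ay yb]; split; [lra|rewrite ay].
Qed.

Lemma int_one a b : a <= b -> \int[leb]_(y in `[a, b]) (1 : R) = b - a.
Proof.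
move=> ab; rewrite Rintegral_cst ?mul1r; last exact: measurable_itv.
have := lebesgue_measure_itv (`[a, b] : interval R); rewrite /= lte_fin.
have [ab'|ba] := ltrP a b; first by move=> /(congr1 fine).
by move=> /(congr1 fine) /= ->; lra.
Qed.

End LebesgueIntegrals.

Section StepDensities.
Context (R : realType).
Local Notation leb := (@lebesgue_measure R).
Implicit Types (a b t x : R) (f F : R -> R).

(* A step function [sum_i c_i 1_[a_i,b_i[] is the list of the [(c_i, (a_i, b_i))]. *)
Definition step := seq (R * (R * R)).
Implicit Types (L : step).

Definition wf_step L := all (fun t : R * (R * R) => [&& 0 <= t.2.1, t.2.1 <= t.2.2 & t.2.2 <= 1]) L.

Definition dens L x : R := \sum_(t <- L) t.1 * (t.2.1 <= x < t.2.2)%R%:R.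

(** The integral of [F'] against the step function, by the fundamental theorem of calculus: [F = id]
    gives the mass and [F = x^2 / 2] the first moment. *)
Definition incr L F : R := \sum_(t <- L) t.1 * (F t.2.2 - F t.2.1).

(** For ordered intervals this is the primitive of [dens L] that vanishes far to the left, and
    [cumul2 L] is the next primitive. *)
Definition cumul L x : R := \sum_(t <- L) t.1 * (ramp (x - t.2.1) - ramp (x - t.2.2)).

Definition cumul2 L x : R :=
  \sum_(t <- L) t.1 * (half_sq (x - t.2.1) - half_sq (x - t.2.2)).

Definition step_int L f : R :=
  \sum_(t <- L) t.1 * \int[leb]_(x in `[t.2.1, t.2.2]) f x.

Lemma measurable_co_indic a b :
  measurable_fun [set: measurableTypeR R] (fun x : R => (a <= x < b)%R%:R : R).
Proof.
rewrite (_ : (fun x => _) = \1_(`[a, b[%classic : set R)).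
  by apply: measurable_indic; exact: measurable_itv.
by apply/funext => x; rewrite indicE mem_setE in_itv.
Qed.

Lemma measurable_dens L : measurable_fun [set: measurableTypeR R] (dens L).
Proof.
apply: measurable_sum => t; apply: measurable_funM => //.
exact: measurable_co_indic.
Qed.

Lemma bounded_leb_integrable f (A : set R) (C : R) : measurable A -> A `<=` I01 R ->
  measurable_fun (I01 R : set (measurableTypeR R)) f ->
  (forall x, I01 R x -> `|f x| <= C) -> leb.-integrable A (EFin \o f).
Proof.
move=> mA A01 mf fC; have mI : measurable (I01 R : set (measurableTypeR R)).
  exact: measurable_itv.
apply: (integrableS mI mA A01).
apply: measurable_bounded_integrable => //.
  have := lebesgue_measure_itv (`[0, 1] : interval R).
  by rewrite /= lte_fin ltr01 => ->; rewrite -EFinB ltry.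
exists C; split; first exact: num_real.
by move=> r Cr x Ix /=; rewrite (le_trans (fC _ Ix)) ?ltW.
Qed.

(** Induction on the list; as [f] and step functions are bounded, every product is integrable and
    the integral splits. *)
Lemma int_dens L f (C : R) : wf_step L ->
  measurable_fun (I01 R : set (measurableTypeR R)) f ->
  (forall x, I01 R x -> `|f x| <= C) ->
  \int[leb]_(x in I01 R) (f x * dens L x) = step_int L f.
Proof.
move=> + mf fC; have mI : measurable (I01 R : set (measurableTypeR R)).
  exact: measurable_itv.
have mD L' : measurable_fun (I01 R : set (measurableTypeR R)) (dens L').
  by apply: measurable_funTS; exact: measurable_dens.
have bD L' x : `|dens L' x| <= \sum_(t <- L') `|t.1|.
  apply: le_trans (ler_norm_sum _ _ _) _; apply: ler_sum => t _.
  by rewrite normrM ler_piMr// ger0_norm ?ler0n// lern1 leq_b1.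
have C0 : 0 <= C by apply: le_trans (fC 0 _) => //; apply/I01P; rewrite lexx ler01.
have intf (g : R -> R) (K : R) : measurable_fun (I01 R : set (measurableTypeR R)) g ->
    (forall x, `|g x| <= K) -> leb.-integrable (I01 R) (EFin \o (fun x => f x * g x)).
  move=> mg gK; apply: (@bounded_leb_integrable _ _ (C * K)) => //.
    exact: measurable_funM.
  by move=> x Ix; rewrite normrM ler_pM// fC.
elim: L => [_|[c [a b]] L IHL].
  rewrite /step_int big_nil -[RHS](Rintegral_set0 leb f).
  rewrite Rintegral_set0 (@eq_Rintegral _ _ _ leb _ (cst 0)).
    by rewrite Rintegral_cst ?mul0r.
  by move=> x _; rewrite /dens big_nil mulr0.
rewrite /wf_step /= => /andP[/and3P[a0 ab b1] wfL].
rewrite /step_int big_cons -/(step_int L f) -IHL//.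
pose g x : R := (a <= x < b)%R%:R.
have mg : measurable_fun (I01 R : set (measurableTypeR R)) g.
  by apply: measurable_funTS; exact: measurable_co_indic.
have gi : leb.-integrable (I01 R) (EFin \o (fun x => f x * g x)).
  by apply: (intf _ 1) => // x; rewrite /g ger0_norm ?ler0n// lern1 leq_b1.
have Di : leb.-integrable (I01 R) (EFin \o (fun x => f x * dens L x)).
  exact: intf (mD L) (bD L).
have cgi : leb.-integrable (I01 R) (EFin \o (fun x => c * (f x * g x))).
  exact: (integrableZl mI c gi).
transitivity (\int[leb]_(x in I01 R) (c * (f x * g x) + f x * dens L x)).
  by apply: eq_Rintegral => x _; rewrite /dens big_cons /= -/(dens L x) mulrDr mulrCA.
rewrite RintegralD// RintegralZl//; congr (_ * _ + _) => /=.
have abI : `[a, b[ `<=` I01 R.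
  by move=> x /=; rewrite in_itv/= => /andP[ax xb]; apply/I01P; lra.
have abI' : `[a, b] `<=` I01 R.
  by move=> x /=; rewrite in_itv/= => /andP[ax xb]; apply/I01P; lra.
(* [dens] uses half-open intervals and [step_int] closed ones; the right endpoint is
   Lebesgue-null. *)
rewrite -[RHS]Rintegral_itv_bndo_bndc; last first.
  by apply: (@bounded_leb_integrable _ _ C) => //; exact: measurable_itv.
rewrite -[X in _ = \int[leb]_(x in X) f x](setIidr abI) Rintegral_mkcondr.
apply: eq_Rintegral => x _; rewrite patchE /g mem_setE in_itv/=.
by case: ifPn => _; rewrite ?mulr1 ?mulr0.
Qed.

Lemma dens_out L x : wf_step L -> ~ I01 R x -> dens L x = 0.
Proof.
move=> /allP wfL Ix; rewrite /dens big_seq big1// => t /wfL /and3P[a0 ab b1].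
case: (boolP (_ <= _ < _)) => [/andP[ax xb]|_]; last by rewrite mulr0.
by case: Ix; apply/I01P; lra.
Qed.

Lemma step_int1 L : wf_step L -> step_int L (fun=> 1) = incr L id.
Proof.
move=> /allP wfL; rewrite /step_int big_seq [RHS]big_seq.
by apply: eq_bigr => t /wfL /and3P[_ ab _]; rewrite int_one.
Qed.

Lemma step_int_below L x : wf_step L ->
  step_int L (\1_(`]-oo, x[%classic : set R) : R -> R) = cumul L x.
Proof.
move=> /allP wfL; rewrite /step_int big_seq /cumul [RHS]big_seq.
by apply: eq_bigr => t /wfL /and3P[_ ab _]; rewrite int_below.
Qed.

Lemma step_int_id L : wf_step L -> step_int L id = incr L (fun x => x ^+ 2 / 2).
Proof.
move=> /allP wfL; rewrite /step_int big_seq [RHS]big_seq.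
apply: eq_bigr => t /wfL /and3P[_ ab _].
have := int_linear 0 ab; rewrite !subr0 => <-.
by congr (_ * _); apply: eq_Rintegral => x _; rewrite subr0.
Qed.

Lemma cumul_continuous L : continuous (cumul L).
Proof.
elim: L => [|[c [u v]] L IHL].
  rewrite (_ : cumul [::] = cst 0); first exact: cst_continuous.
  by apply/funext => x; rewrite /cumul big_nil.
rewrite (_ : cumul _ = (fun x => c * (ramp (x - u) - ramp (x - v)) + cumul L x)).
  move=> x; apply: cvgD; last exact: IHL.
  by apply: cvgM; [exact: cvg_cst|apply: cvgB; exact: ramp_continuous].
by apply/funext => x; rewrite /cumul big_cons.
Qed.

Lemma int_cumul L a b : a <= b ->
  \int[leb]_(x in `[a, b]) cumul L x = cumul2 L b - cumul2 L a.
Proof.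
move=> ab; have ir t : leb.-integrable `[a, b] (EFin \o (fun x => ramp (x - t))).
  exact/continuous_integrable_itv/ramp_continuous.
have mI : measurable (`[a, b]%classic : set (measurableTypeR R)) by exact: measurable_itv.
elim: L => [|[c [u v]] L IHL].
  rewrite /cumul2 !big_nil subrr (@eq_Rintegral _ _ _ leb _ (cst 0)).
    by rewrite Rintegral_cst ?mul0r.
  by move=> x _; rewrite /cumul big_nil.
have iB : leb.-integrable `[a, b] (EFin \o (fun x => ramp (x - u) - ramp (x - v))).
  exact: (integrableB mI (ir u) (ir v)).
have icB : leb.-integrable `[a, b] (EFin \o (fun x => c * (ramp (x - u) - ramp (x - v)))).
  exact: (integrableZl mI c iB).
transitivity (\int[leb]_(x in `[a, b]) (c * (ramp (x - u) - ramp (x - v)) + cumul L x)).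
  by apply: eq_Rintegral => x _; rewrite /cumul big_cons.
rewrite RintegralD//; last exact/continuous_integrable_itv/cumul_continuous.
rewrite RintegralZl// RintegralB// !int_ramp// IHL /cumul2 !big_cons /=; lra.
Qed.

Lemma step_int_cumul L L' : wf_step L -> step_int L (cumul L') = incr L (cumul2 L').
Proof.
move=> /allP wfL; rewrite /step_int big_seq [RHS]big_seq.
by apply: eq_bigr => t /wfL /and3P[_ ab _]; rewrite int_cumul.
Qed.

End StepDensities.

(** * Probability laws with a step density *)

Section StepMeasures.
Context (R : realType).
Local Notation leb := (@lebesgue_measure R).
Implicit Types (L : step R) (P Q : probability R R).

Definition step_law P L := [/\ on01 P, atomless P,
  (forall x, lcdf P x = cumul L x) &
  (forall f : R -> R, {within I01 R, continuous f} ->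
    \int[P]_(x in I01 R) f x = step_int L f)].

Definition full_support P := forall U : set R, open U -> (U `&` I01 R) !=set0 ->
  (0 < P (U `&` I01 R))%E.

(** Full support holds because an open set meeting the unit interval contains some [[p, q[] in it,
    of mass at least [c * (q - p)]. The lower bound is asked on [[0, 1[] because half-open steps
    vanish at 1. *)
Lemma step_probability L : wf_step L -> (forall x, 0 <= dens L x) ->
  incr L id = 1 -> exists P, step_law P L /\
  ((exists2 c : R, 0 < c & forall x, 0 <= x < 1 -> c <= dens L x) -> full_support P).
Proof.
move=> wfL d0 mass1.
have mI : measurable (I01 R : set (measurableTypeR R)) by exact: measurable_itv.
have mD := measurable_dens L.
have mED : measurable_fun [set: measurableTypeR R] (EFin \o dens L) by exact/measurable_EFinP.
have m1 : measurable_fun (I01 R : set (measurableTypeR R)) (fun=> 1 : R).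
  exact: measurable_cst.
have int1 : \int[leb]_(x in I01 R) dens L x = 1.
  rewrite -mass1 -step_int1// -(int_dens (C := 1) wfL m1) => [|x _]; last by rewrite normr1.
  by apply: eq_Rintegral => x _; rewrite mul1r.
have Dfin : (\int[leb]_(x in I01 R) (dens L x)%:E = 1)%E.
  rewrite -[LHS]fineK; last first.
    have : leb.-integrable (I01 R) (EFin \o dens L).
      apply: (@bounded_leb_integrable _ _ _ (\sum_(t <- L) `|t.1|)) => //.
        exact: measurable_funTS.
      move=> x _; apply: le_trans (ler_norm_sum _ _ _) _; apply: ler_sum => t _.
      by rewrite normrM ler_piMr// ger0_norm ?ler0n// lern1 leq_b1.
    exact: integrable_fin_num.
  by rewrite -[fine _]/(Rintegral leb (I01 R) (dens L)) int1.
have DT : (\int[leb]_x (dens L x)%:E = 1)%E.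
  rewrite -Dfin [RHS]integral_mkcond; apply: eq_integral => x _.
  rewrite patchE; case: ifPn => // /negP; rewrite inE => Ix.
  by rewrite dens_out.
have [P [PE Pint]] := density_probability mD d0 DT.
have P1 : on01 P by rewrite /on01 PE.
exists P; split; last first.
  move=> [c c0 cD] U oU [x [Ux /I01P/andP[x0 x1]]].
  have /nbhs_ballP[r /= r0 xr] : nbhs x U by exact: open_nbhs_nbhs.
  pose p := Num.max 0 (x - r / 2); pose q := Num.min 1 (x + r / 2).
  have p0 : 0 <= p by rewrite le_max lexx.
  have xp : x - r / 2 <= p by rewrite le_max lexx orbT.
  have q1 : q <= 1 by rewrite ge_min lexx.
  have qx : q <= x + r / 2 by rewrite ge_min lexx orbT.
  have pq : p < q by rewrite gt_max !lt_min; apply/andP; split; apply/andP; split; lra.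
  apply: (@lt_le_trans _ _ (P `[p, q[%classic)); last first.
    apply: le_measure; rewrite ?inE.
    - exact: measurable_itv.
    - by apply: measurableI; [exact: open_measurable|exact: measurable_I01].
    - move=> y; rewrite /= in_itv/= => /andP[py yq]; split; last by apply/I01P; lra.
      by apply: xr; rewrite /ball/= ltr_norml; apply/andP; split; lra.
  rewrite PE; apply: (@lt_le_trans _ _ (\int[leb]_(x in `[p, q[) c%:E)%E).
    rewrite integral_cst; last exact: measurable_itv.
    have := lebesgue_measure_itv (`[p, q[ : interval R); rewrite /= lte_fin pq => ->.
    by rewrite -EFinB -EFinM lte_fin mulr_gt0// subr_gt0.
  apply: ge0_le_integral => //.
  - by move=> y _; rewrite lee_fin ltW.
  - exact: measurable_funTS.
  - by move=> y; rewrite /= in_itv/= => /andP[py yq]; rewrite lee_fin cD//; lra.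
(* Bounded measurable functions cover both the indicators behind [lcdf] and the continuous test
   functions. *)
have key (f : R -> R) (C : R) : measurable_fun (I01 R : set (measurableTypeR R)) f ->
    (forall x, I01 R x -> `|f x| <= C) -> \int[P]_(x in I01 R) f x = step_int L f.
  move=> mf fC; rewrite -(int_dens wfL mf fC) /Rintegral Pint//.
  by apply: bounded_integrable fC; exact: mf.
split => //.
- by move=> x; rewrite PE integral_set1.
- move=> x; rewrite lcdf_int// (key _ 1) ?step_int_below//.
  by move=> y _; rewrite indicE; case: (_ \in _); rewrite ?normr1 ?normr0.
- move=> f cf; have [C _ fC] := continuous_bounded_I01 cf.
  exact: (key _ C (continuous_measurable_I01 cf) fC).
Qed.

Lemma pw_step P Q L L' : wf_step L -> step_law P L -> step_law Q L' ->
  pw P Q = incr L (cumul2 L').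
Proof.
move=> wfL [_ _ _ Pint] [_ _ QE _].
rewrite -step_int_cumul// -Pint; last by apply: continuous_subspaceT; exact: cumul_continuous.
by apply: eq_Rintegral => x _; rewrite QE.
Qed.

Lemma proper_step P L : wf_step L -> step_law P L ->
  incr L (fun x => x ^+ 2 / 2) = 2^-1 -> proper_meas P.
Proof.
move=> wfL [_ _ _ Pint] mean.
have cid : {within I01 R, continuous (id : R -> R)}.
  by apply: continuous_subspaceT => x; exact: cvg_id.
by rewrite /proper_meas -/(test_int P id) test_intE// Pint// step_int_id// mean.
Qed.

Lemma proper_mean P : proper_meas P -> \int[P]_(x in I01 R) x = 2^-1.
Proof. by rewrite /proper_meas /Rintegral => ->. Qed.

End StepMeasures.

(** * The bilinear form on step functions and the blocks it annihilates *)

Section StepAlgebra.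
Context (R : realType).
Implicit Types (L : step R) (a b s w x k : R) (F G : R -> R).

Definition scale k L : step R := [seq (k * t.1, t.2) | t <- L].

Lemma incr_cat L L' F : incr (L ++ L') F = incr L F + incr L' F.
Proof. by rewrite /incr big_cat. Qed.

Lemma incr_scale k L F : incr (scale k L) F = k * incr L F.
Proof. by rewrite /incr big_map mulr_sumr; apply: eq_bigr => t _; rewrite mulrA. Qed.

Lemma incr0 L : incr L (fun=> 0) = 0.
Proof. by rewrite /incr big1// => t _; rewrite subrr mulr0. Qed.

Lemma incrD L F G : incr L (fun x => F x + G x) = incr L F + incr L G.
Proof. by rewrite /incr -big_split; apply: eq_bigr => t _ /=; lra. Qed.

Lemma incrZ L k F : incr L (fun x => k * F x) = k * incr L F.
Proof. by rewrite /incr mulr_sumr; apply: eq_bigr => t _ /=; lra. Qed.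

Lemma dens_cat L L' x : dens (L ++ L') x = dens L x + dens L' x.
Proof. by rewrite /dens big_cat. Qed.

Lemma dens_scale k L x : dens (scale k L) x = k * dens L x.
Proof. by rewrite /dens big_map mulr_sumr; apply: eq_bigr => t _; rewrite mulrA. Qed.

Lemma cumul2_cat L L' : cumul2 (L ++ L') = fun x => cumul2 L x + cumul2 L' x.
Proof. by apply/funext => x; rewrite /cumul2 big_cat. Qed.

Lemma cumul2_scale k L : cumul2 (scale k L) = fun x => k * cumul2 L x.
Proof.
apply/funext => x; rewrite /cumul2 big_map mulr_sumr.
by apply: eq_bigr => t _; rewrite mulrA.
Qed.

Lemma step_int_cat L L' F : step_int (L ++ L') F = step_int L F + step_int L' F.
Proof. by rewrite /step_int big_cat. Qed.

Lemma step_int_scale k L F : step_int (scale k L) F = k * step_int L F.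
Proof. by rewrite /step_int big_map mulr_sumr; apply: eq_bigr => t _; rewrite mulrA. Qed.

Lemma wf_cat L L' : wf_step (L ++ L') = wf_step L && wf_step L'.
Proof. exact: all_cat. Qed.

Lemma wf_scale k L : wf_step (scale k L) = wf_step L.
Proof. by rewrite /wf_step all_map. Qed.

(** The form [pw] carried over to signed step functions: the double integral of
    [dens L x * dens L' y] over [y < x]. *)
Definition pairing L L' : R := incr L (cumul2 L').

Lemma pairing_catl L1 L2 L : pairing (L1 ++ L2) L = pairing L1 L + pairing L2 L.
Proof. exact: incr_cat. Qed.

Lemma pairing_catr L L1 L2 : pairing L (L1 ++ L2) = pairing L L1 + pairing L L2.
Proof. by rewrite /pairing cumul2_cat incrD. Qed.

Lemma pairing_scalel k L L' : pairing (scale k L) L' = k * pairing L L'.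
Proof. exact: incr_scale. Qed.

Lemma pairing_scaler k L L' : pairing L (scale k L') = k * pairing L L'.
Proof. by rewrite /pairing cumul2_scale incrZ. Qed.

Lemma pairing_nilr L : pairing L [::] = 0.
Proof.
rewrite /pairing (_ : cumul2 [::] = fun=> 0) ?incr0//.
by apply/funext => x; rewrite /cumul2 big_nil.
Qed.

Lemma pairing_nill L : pairing [::] L = 0.
Proof. by rewrite /pairing /incr big_nil. Qed.

Lemma half_sq_ge0 (t : R) : 0 <= t -> half_sq t = t ^+ 2 / 2.
Proof. by move=> t0; rewrite /half_sq ramp_ge0. Qed.

Lemma half_sq_le0 (t : R) : t <= 0 -> half_sq t = 0.
Proof. by move=> t0; rewrite /half_sq ramp_le0// expr0n mul0r. Qed.

Ltac half_sq_cases := repeat match goal with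
  |- context [half_sq ?t] => first
    [rewrite (@half_sq_ge0 t); last lra | rewrite (@half_sq_le0 t); last lra] end.

Definition unif01 : step R := [:: (1, (0, 1))].

(** The uniform distribution function is [x] on the unit interval, so only the first moment of [L]
    is seen. With [pairing_unif01l], the uniform law pairs to 1/2 with every law of mean 1/2, on
    either side. *)
Lemma pairing_unif01r L : wf_step L -> pairing L unif01 = incr L (fun x => x ^+ 2 / 2).
Proof.
move=> /allP wfL; rewrite /pairing /incr big_seq [RHS]big_seq.
apply: eq_bigr => -[c [a b]] /wfL /and3P[/= a0 ab b1].
by rewrite /cumul2 !big_seq1 /=; half_sq_cases; field.
Qed.

Lemma pairing_unif01l L : wf_step L ->
  pairing unif01 L = incr L id - incr L (fun x => x ^+ 2 / 2).
Proof.
move=> /allP wfL; rewrite {1}/pairing {1}/incr big_seq1 /= mul1r.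
rewrite /cumul2 /incr -!sumrB big_seq [RHS]big_seq.
apply: eq_bigr => -[c [a b]] /wfL /and3P[/= a0 ab b1].
by half_sq_cases; field.
Qed.

(* Integrating against this density takes a third difference, hence kills
   quadratic polynomials. *)
Definition block s w : step R :=
  [:: (1, (s, s + w)); (- 2, (s + w, s + 2 * w)); (1, (s + 2 * w, s + 3 * w))].

Lemma incr_block s w F :
  incr (block s w) F = F (s + 3 * w) - 3 * F (s + 2 * w) + 3 * F (s + w) - F s.
Proof. by rewrite /incr /block !big_cons big_nil /=; lra. Qed.

Lemma cumul2_block s w x : cumul2 (block s w) x =
  half_sq (x - s) - 3 * half_sq (x - (s + w)) + 3 * half_sq (x - (s + 2 * w))
  - half_sq (x - (s + 3 * w)).
Proof. by rewrite /cumul2 /block !big_cons big_nil /=; lra. Qed.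

Lemma incr_block_id s w : incr (block s w) id = 0.
Proof. by rewrite incr_block; lra. Qed.

Lemma incr_block_sq s w : incr (block s w) (fun x => x ^+ 2 / 2) = 0.
Proof. by rewrite incr_block; field. Qed.

(** When [t] is outside the block, [half_sq (x - t)] is a single polynomial of degree at most 2
    there, killed by the third difference. *)
Lemma incr_block_out s w (t : R) : 0 < w -> t <= s \/ s + 3 * w <= t ->
  incr (block s w) (fun x => half_sq (x - t)) = 0.
Proof. by move=> w0 [st|st]; rewrite incr_block; half_sq_cases; field. Qed.

(** To the right of the block this expresses that the block has zero mass and zero first moment. *)
Lemma cumul2_block_out s w x : 0 < w -> x <= s \/ s + 3 * w <= x ->
  cumul2 (block s w) x = 0.
Proof. by move=> w0 [st|st]; rewrite cumul2_block; half_sq_cases; field. Qed.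

(** No endpoint lies strictly between [a] and [b]; a step may contain the whole interval, so the
    step function is constant there rather than zero. *)
Definition avoids a b L := forall t, t \in L ->
  (t.2.1 <= a \/ b <= t.2.1) /\ (t.2.2 <= a \/ b <= t.2.2).

Lemma pairing_blockl a b s w L : 0 < w -> a <= s -> s + 3 * w <= b -> avoids a b L ->
  pairing (block s w) L = 0.
Proof.
move=> w0 as_ sb; elim: L => [_|[c [u v]] L IHL av]; first exact: pairing_nilr.
rewrite -cat1s pairing_catr IHL ?addr0; last by move=> t tL; apply: av; rewrite in_cons tL orbT.
have [/= uo vo] := av _ (mem_head _ _).
rewrite /pairing (_ : cumul2 _ = fun x => c * (half_sq (x - u) + -1 * half_sq (x - v))); last first.
  by apply/funext => x; rewrite /cumul2 big_seq1 /=; lra.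
rewrite incrZ incrD incrZ !incr_block_out//; first by rewrite mulr0 addr0 mulr0.
- by case: vo; [left|right]; lra.
- by case: uo; [left|right]; lra.
Qed.

Lemma pairing_blockr a b s w L : 0 < w -> a <= s -> s + 3 * w <= b -> avoids a b L ->
  pairing L (block s w) = 0.
Proof.
move=> w0 as_ sb av; rewrite /pairing /incr big_seq big1// => t /av[uo vo].
rewrite !cumul2_block_out ?subrr ?mulr0//.
- by case: uo; [left|right]; lra.
- by case: vo; [left|right]; lra.
Qed.

(** This nonzero value is the interaction of [f_ r] with [e_ r]. A block pairs to 0 with itself, the
    form being antisymmetric on step functions of zero mass. *)
Lemma pairing_block_shift s w : 0 < w ->
  pairing (block (s + w) w) (block s w) = w ^+ 2.
Proof.
by move=> w0; rewrite /pairing incr_block !cumul2_block; half_sq_cases; field.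
Qed.

Lemma pairing_block_self s w : 0 < w -> pairing (block s w) (block s w) = 0.
Proof.
by move=> w0; rewrite /pairing incr_block !cumul2_block; half_sq_cases; field.
Qed.

Lemma dens_block s w x : 0 < w ->
  `|dens (block s w) x| <= 2 * (s <= x < s + 3 * w)%R%:R.
Proof.
move=> w0; rewrite /dens /block !big_cons big_nil /=.
have [h0|h0] := lerP s x; have [h1|h1] := ltrP x (s + w);
have [h2|h2] := ltrP x (s + 2 * w); have [h3|h3] := ltrP x (s + 3 * w) => /=;
rewrite ler_norml; apply/andP; split; lra.
Qed.

Lemma wf_block s w : 0 < w -> 0 <= s -> s + 3 * w <= 1 -> wf_step (block s w).
Proof.
move=> w0 s0 s1; rewrite /wf_step /=.
by do ![apply/andP; split=> //]; lra.
Qed.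

End StepAlgebra.

(** * Perturbations and balayage *)

Section Perturbations.
Context (R : realType) (h : R).
Hypotheses (h_gt0 : 0 < h) (h_le1 : h <= 1).
Implicit Types (L b : step R) (c : nat -> R) (r m n : nat).

Definition edge r : R := h / 2 ^+ r.

Lemma edge_gt0 r : 0 < edge r.
Proof. by rewrite /edge divr_gt0// exprn_gt0. Qed.

Lemma edgeS r : edge r.+1 = edge r / 2.
Proof. by rewrite /edge exprS invfM mulrA mulrAC. Qed.

Lemma edge_le r m : (r <= m)%N -> edge m <= edge r.
Proof.
move=> /subnK <-; elim: (m - r)%N => // k IHk; rewrite addSn edgeS.
by apply: le_trans IHk; have := edge_gt0 (k + r); lra.
Qed.

Lemma edge_lt r m : (r < m)%N -> edge m <= edge r / 2.
Proof. by move=> rm; rewrite -edgeS; exact: edge_le. Qed.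

Lemma edge0 : edge 0 = h.
Proof. by rewrite /edge expr0 divr1. Qed.

Lemma edge_leh r : edge r <= h.
Proof. by rewrite -edge0; exact: edge_le. Qed.

(* The cells [[edge r / 2, edge r[] are disjoint; [e_ r] and [f_ r] live in the
   [r]-th one and have nonzero pairing. *)
Definition e_ r : step R := block (edge r / 2) (edge r / 8).
Definition f_ r : step R := block (edge r / 2 + edge r / 8) (edge r / 8).

Fixpoint fcomb c n : step R :=
  if n is m.+1 then fcomb c m ++ scale (c m) (f_ m) else [::].

Definition pert c n : step R := e_ n ++ fcomb c n.
(** The perturbation is at least -2 when the coefficients are at most 1 in absolute value, so the
    factor 1/4 keeps the density at least 1/2 on [[0, 1[]. *)
Definition rho c n : step R := unif01 R ++ scale (4^-1) (pert c n).
Definition mixt (eta : R) b c n : step R := scale (1 - eta) b ++ scale eta (rho c n).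

Definition avoid r L := avoids (edge r / 2) (edge r) L.

Lemma avoid_cat r L L' : avoid r L -> avoid r L' -> avoid r (L ++ L').
Proof. by move=> aL aL' t; rewrite mem_cat => /orP[]; [exact: aL|exact: aL']. Qed.

Lemma avoid_scale r k L : avoid r L -> avoid r (scale k L).
Proof. by move=> aL _ /mapP[t tL ->]; exact: aL t tL. Qed.

Lemma avoid_block r m (s w : R) : r != m -> 0 < w -> edge m / 2 <= s ->
  s + 3 * w <= edge m -> avoid r (block s w).
Proof.
move=> rm w0 ms sm; have key (t : R) : s <= t -> t <= s + 3 * w ->
    t <= edge r / 2 \/ edge r <= t.
  move=> st ts; have [rm'|rm'|/eqP rm'] := ltngtP r m; last by rewrite rm' in rm.
  - by left; have := edge_lt rm'; lra.
  - by right; have := edge_lt rm'; lra.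
by move=> t; rewrite !inE => /or3P[] /eqP -> /=; split; apply: key; lra.
Qed.

Lemma avoid_e r m : r != m -> avoid r (e_ m).
Proof. by move=> rm; have := edge_gt0 m; move=> ?; apply: (avoid_block rm); lra. Qed.

Lemma avoid_f r m : r != m -> avoid r (f_ m).
Proof. by move=> rm; have := edge_gt0 m; move=> ?; apply: (avoid_block rm); lra. Qed.

Lemma avoid_fcomb r c n : (n <= r)%N -> avoid r (fcomb c n).
Proof.
elim: n => [_ t|n IHn nr]; first by rewrite in_nil.
apply: avoid_cat; first exact/IHn/ltnW.
by apply/avoid_scale/avoid_f; rewrite gtn_eqF.
Qed.

Lemma pairing_el r L : avoid r L -> pairing (e_ r) L = 0.
Proof. by have := edge_gt0 r; move=> ? /pairing_blockl; apply; lra. Qed.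

Lemma pairing_er r L : avoid r L -> pairing L (e_ r) = 0.
Proof. by have := edge_gt0 r; move=> ? /pairing_blockr; apply; lra. Qed.

Lemma pairing_fl r L : avoid r L -> pairing (f_ r) L = 0.
Proof. by have := edge_gt0 r; move=> ? /pairing_blockl; apply; lra. Qed.

Lemma pairing_fr r L : avoid r L -> pairing L (f_ r) = 0.
Proof. by have := edge_gt0 r; move=> ? /pairing_blockr; apply; lra. Qed.

Lemma pairing_fcombl c n L : (forall r, pairing (f_ r) L = 0) -> pairing (fcomb c n) L = 0.
Proof.
move=> fL; elim: n => [|n IHn]; first exact: pairing_nill.
by rewrite pairing_catl IHn pairing_scalel fL mulr0 addr0.
Qed.

Lemma pairing_fcombr c n L : (forall r, pairing L (f_ r) = 0) -> pairing L (fcomb c n) = 0.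
Proof.
move=> fL; elim: n => [|n IHn]; first exact: pairing_nilr.
by rewrite pairing_catr IHn pairing_scaler fL mulr0 addr0.
Qed.

(** [f_ r] pairs to 0 with every [f_ q], by [pairing_block_self] or because the cells differ, and
    with [e_ m] unless [r = m]. *)
Lemma pairing_f_pert r c m :
  pairing (f_ r) (pert c m) = (r == m)%:R * (edge m / 8) ^+ 2.
Proof.
have w0 q : 0 < edge q / 8 by have := edge_gt0 q; lra.
rewrite pairing_catr [X in _ + X]pairing_fcombr ?addr0; last first.
  move=> q; have [->|rq] := eqVneq r q; first exact: pairing_block_self.
  exact/pairing_fl/avoid_f.
have [->|rm] := eqVneq r m; first by rewrite mul1r pairing_block_shift.
by rewrite mul0r pairing_fl//; exact: avoid_e.
Qed.

(** [e_ n] meets nothing in [pert c' m], whose cells all have index at most [m]; among the [c q]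
    multiples of [f_ q] with [q < n], only [q = m] meets [e_ m]. *)
Lemma pairing_pert c c' m n : (m < n)%N ->
  pairing (pert c n) (pert c' m) = c m * (edge m / 8) ^+ 2.
Proof.
move=> mn; rewrite pairing_catl pairing_el ?add0r; last first.
  by apply: avoid_cat; [apply: avoid_e; rewrite gtn_eqF|exact/avoid_fcomb/ltnW].
have -> : pairing (fcomb c n) (pert c' m) = (m < n)%N%:R * (c m * (edge m / 8) ^+ 2).
  elim: n {mn} => [|n IHn]; first by rewrite pairing_nill mul0r.
  rewrite pairing_catl IHn pairing_scalel pairing_f_pert.
  by have [mn|mn|->] := ltngtP m n; rewrite ?mul0r ?mul1r ?mulr0 ?addr0 ?add0r// ltnS;
    rewrite ?(ltnW mn) ?(leqNgt m) ?mn ?leqnn ?mul1r ?mul0r.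
by rewrite mn mul1r.
Qed.

(** Probability densities of mean 1/2 that are constant on every cell, hence orthogonal to all
    perturbations. *)
Definition admissible b := [/\ wf_step b, forall r, avoid r b, incr b id = 1,
  incr b (fun x => x ^+ 2 / 2) = 2^-1 & forall x, 0 <= dens b x].

Lemma admissible_unif01 : admissible (unif01 R).
Proof.
split.
- by rewrite /wf_step /= lexx ler01 lexx.
- move=> r t; rewrite inE => /eqP -> /=; split; [left|right].
    by have := edge_gt0 r; lra.
  exact: le_trans (edge_leh r) h_le1.
- by rewrite /incr big_seq1 /=; lra.
- by rewrite /incr big_seq1 /=; lra.
- by move=> x; rewrite /dens big_seq1 /= mul1r ler0n.
Qed.

Lemma wf_pert c n : wf_step (pert c n).
Proof.
have key r : edge r <= 1 by exact: le_trans (edge_leh r) h_le1.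
rewrite wf_cat; apply/andP; split.
  by have := edge_gt0 n; have := key n; move=> *; apply: wf_block; lra.
elim: n => // n IHn; rewrite wf_cat IHn wf_scale andTb.
by have := edge_gt0 n; have := key n; move=> *; apply: wf_block; lra.
Qed.

Lemma incr_pert c n F : (forall s w : R, incr (block s w) F = 0) -> incr (pert c n) F = 0.
Proof.
move=> F0; rewrite incr_cat F0 add0r; elim: n => [|n IHn].
  by rewrite /incr big_nil.
by rewrite incr_cat IHn incr_scale F0 mulr0 addr0.
Qed.

Lemma pairing_pertl c n L : (forall r, avoid r L) -> pairing (pert c n) L = 0.
Proof.
by move=> aL; rewrite pairing_catl pairing_el// pairing_fcombl ?addr0// => r; exact: pairing_fl.
Qed.

Lemma pairing_pertr c n L : (forall r, avoid r L) -> pairing L (pert c n) = 0.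
Proof.
by move=> aL; rewrite pairing_catr pairing_er// pairing_fcombr ?addr0// => r; exact: pairing_fr.
Qed.

(** Expand bilinearly: pairings with the uniform part are 1/2, admissible laws pair to 0 with
    perturbations, and the two perturbations contribute with the factor [(eta / 4)^2]. *)
Lemma pairing_mixt eta b b' c c' m n : admissible b -> admissible b' -> (m < n)%N ->
  pairing (mixt eta b c n) (mixt eta b' c' m) - 2^-1 =
  (1 - eta) ^+ 2 * (pairing b b' - 2^-1) + eta ^+ 2 / 16 * (c m * (edge m / 8) ^+ 2).
Proof.
move=> [wb ab b1 b2 _] [wb' ab' b1' b2' _] mn.
have [wu au u1 u2 _] := admissible_unif01.
have := pairing_pert c c' mn; rewrite /mixt /rho.
have [pb pu] := (pairing_pertl c n ab', pairing_pertl c n au).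
have [pb' pu'] := (pairing_pertr c' m ab, pairing_pertr c' m au).
move: (pert c n) (pert c' m) pb pu pb' pu' => p p' pb pu pb' pu' pp.
rewrite !(pairing_catl, pairing_catr, pairing_scalel, pairing_scaler).
rewrite pp pb pu pb' pu'.
rewrite !pairing_unif01r// pairing_unif01l// b2 b1' b2' u2.
lra.
Qed.

(** The [f_ m] have disjoint supports, so the bound 2 of a single block does not accumulate. The
    support stays right of [edge n], hence off that of [e_ n], as [dens_pert] requires. *)
Lemma dens_fcomb c n x : (forall m, `|c m| <= 1) ->
  `|dens (fcomb c n) x| <= 2 * (edge n <= x < h)%R%:R.
Proof.
move=> c1; elim: n => [|n IHn].
  by rewrite /dens big_nil normr0 mulr_ge0 ?ler0n.
rewrite dens_cat dens_scale; apply: le_trans (ler_normD _ _) _.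
have e0 := edge_gt0 n; have eh := edge_leh n.
have w0 : 0 < edge n / 8 by lra.
have := dens_block (edge n / 2 + edge n / 8) x w0; rewrite -/(f_ n) => fb.
have cf : `|c n * dens (f_ n) x| <= `|dens (f_ n) x|.
  by rewrite normrM ler_piMl.
rewrite edgeS; move: IHn fb cf.
case: (boolP (edge n <= x < h)) => [/andP[h1 h2]|h1];
  case: (boolP (_ <= x < _)) => [/andP[h3 h4]|h3];
  case: (boolP (edge n / 2 <= x < h)) => [/andP[h5 h6]|h5] /= *; try lra;
  by move: h5; rewrite negb_and -ltNge -leNgt => /orP[]; lra.
Qed.

Lemma dens_pert c n x : (forall m, `|c m| <= 1) -> - 2 <= dens (pert c n) x.
Proof.
move=> c1; have := dens_fcomb n x c1; rewrite ler_norml => /andP[fl _].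
have e0 := edge_gt0 n; have w0 : 0 < edge n / 8 by lra.
have := dens_block (edge n / 2) x w0; rewrite ler_norml => /andP[el _].
rewrite dens_cat /e_; move: fl el.
case: (boolP (edge n <= x < h)) => [/andP[h1 h2]|h1];
  case: (boolP (_ <= x < _)) => [/andP[h3 h4]|h3] /=; lra.
Qed.

Lemma wf_rho c n : wf_step (rho c n).
Proof.
by have [wu _ _ _ _] := admissible_unif01; rewrite wf_cat wu wf_scale wf_pert.
Qed.

Lemma dens_rho c n x : (forall m, `|c m| <= 1) -> 0 <= x < 1 -> 2^-1 <= dens (rho c n) x.
Proof.
move=> c1 x01; have := dens_pert n x c1.
have -> : dens (rho c n) x = 1 + 4^-1 * dens (pert c n) x.
  by rewrite dens_cat dens_scale [dens (unif01 R) x]big_seq1 /= x01 mulr1.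
by move=> ?; lra.
Qed.

Lemma dens_rho_ge0 c n x : (forall m, `|c m| <= 1) -> 0 <= dens (rho c n) x.
Proof.
move=> c1; have [x01|x01] := boolP (0 <= x < 1).
  by apply: le_trans (dens_rho n c1 x01); rewrite invr_ge0.
(* The point 1 lies in the unit interval but in no half-open step, so it is treated apart. *)
have [x1|x1] := eqVneq x 1; last first.
  rewrite dens_out//; first exact: wf_rho.
  by move=> /I01P/andP[x0 x1']; move: x01; rewrite x0 lt_neqAle x1 x1'.
rewrite /dens big_seq big1// => t tL; have /allP/(_ t tL)/and3P[_ _ t1] := wf_rho c n.
by rewrite x1 (ltNge 1) t1 andbF mulr0.
Qed.

(** Through [law_bound], the existence of the law bounds [step_int (rho c n) f] by a bound of
    [f]. *)
Lemma rho_law c n : (forall m, `|c m| <= 1) -> exists P, step_law P (rho c n).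
Proof.
move=> c1; have [_ _ u1 _ _] := admissible_unif01.
have [|||P [PL _]] := @step_probability _ (rho c n); last by exists P.
- exact: wf_rho.
- by move=> x; exact: dens_rho_ge0.
- by rewrite incr_cat incr_scale incr_pert ?mulr0 ?addr0// => s w; exact: incr_block_id.
Qed.

Lemma admissible_law b : admissible b -> exists P, step_law P b.
Proof.
by move=> [wb _ b1 _ b0]; have [//|//|//|P [PL _]] := @step_probability _ b; exists P.
Qed.

Lemma mixt_law eta b c n : 0 < eta -> eta <= 1 -> admissible b -> (forall m, `|c m| <= 1) ->
  wf_step (mixt eta b c n) /\
  exists P, [/\ step_law P (mixt eta b c n), in_M0 P & continuous_meas P].
Proof.
move=> eta0 eta1 [wb ab b1 b2 b0] c1; have [wu au u1 u2 _] := admissible_unif01.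
have wm : wf_step (mixt eta b c n) by rewrite wf_cat !wf_scale wb wf_rho.
split=> //; have [||P [PL Psupp]] := @step_probability _ (mixt eta b c n) wm.
- move=> x; rewrite dens_cat !dens_scale addr_ge0// mulr_ge0// ?subr_ge0//; first exact: ltW.
  exact: dens_rho_ge0.
- rewrite incr_cat !incr_scale b1 incr_cat u1 incr_scale incr_pert; first lra.
  by move=> s w; exact: incr_block_id.
exists P; split => //.
  split; first by case: PL.
  apply: (proper_step wm PL).
  rewrite incr_cat !incr_scale b2 incr_cat u2 incr_scale incr_pert; first lra.
  by move=> s w; exact: incr_block_sq.
split; first by case: PL.
apply: Psupp; exists (eta / 2); first by rewrite divr_gt0.
move=> x x01; rewrite dens_cat !dens_scale.
have := dens_rho n c1 x01; have := mulr_ge0 (_ : 0 <= 1 - eta) (b0 x).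
by rewrite subr_ge0 => /(_ eta1) h1 h2; have := ler_wpM2l (ltW eta0) h2; lra.
Qed.

End Perturbations.

(** * Sweeping a measure onto a grid *)

Section Balayage.
Context (R : realType).
Implicit Types (P : probability R R) (f g : R -> R) (x : R).

Lemma Rintegral_dist P f g (e : R) : on01 P -> {within I01 R, continuous f} ->
  {within I01 R, continuous g} -> (forall x, I01 R x -> `|f x - g x| <= e) ->
  `|\int[P]_(x in I01 R) f x - \int[P]_(x in I01 R) g x| <= e.
Proof.
move=> P1 cf cg fg.
have [fi gi] := (continuous_integrable P cf, continuous_integrable P cg).
have cc : {within I01 R, continuous (cst e : R -> R)}.
  by apply: continuous_subspaceT => x; exact: cvg_cst.
have ci := continuous_integrable P cc.
have ce : \int[P]_(x in I01 R) (cst e x) = e.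
  by rewrite (Rintegral_cst P (@measurable_I01 R) e) (congr1 fine P1) /= mulr1.
have cD (u : R -> R) : {within I01 R, continuous u} ->
    {within I01 R, continuous (fun x => u x + cst e x)}.
  by move=> cu; apply: within_continuousD.
have fD := continuous_integrable P (cD f cf).
have gD := continuous_integrable P (cD g cg).
have h1 : \int[P]_(x in I01 R) f x <= \int[P]_(x in I01 R) (g x + cst e x).
  apply: (le_Rintegral (@measurable_I01 R) fi gD) => x /fg.
  by rewrite ler_norml => /andP[_ h] /=; lra.
have h2 : \int[P]_(x in I01 R) g x <= \int[P]_(x in I01 R) (f x + cst e x).
  apply: (le_Rintegral (@measurable_I01 R) gi fD) => x /fg.
  by rewrite ler_norml => /andP[h _] /=; lra.
move: h1 h2; rewrite !RintegralD//; try exact: measurable_I01.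
by rewrite ce => h1 h2; rewrite ler_norml; apply/andP; split; lra.
Qed.

Lemma continuous_lincomb n (a : nat -> R) (F : nat -> R -> R) :
  (forall k, continuous (F k)) -> continuous (fun x => \sum_(0 <= k < n) a k * F k x).
Proof.
move=> cF; elim: n => [|n IHn].
  rewrite (_ : (fun x => _) = cst 0); first exact: cst_continuous.
  by apply/funext => x; rewrite big_geq.
rewrite (_ : (fun x => _) = fun x => \sum_(0 <= k < n) a k * F k x + a n * F n x).
  by move=> x; apply: cvgD; [exact: IHn|apply: cvgM; [exact: cvg_cst|exact: cF]].
by apply/funext => x; rewrite big_nat_recr.
Qed.

Lemma Rintegral_lincomb P n (a : nat -> R) (F : nat -> R -> R) :
  (forall k, continuous (F k)) ->
  \int[P]_(x in I01 R) (\sum_(0 <= k < n) a k * F k x) =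
  \sum_(0 <= k < n) a k * \int[P]_(x in I01 R) F k x.
Proof.
move=> cF; have iF k : P.-integrable (I01 R) (EFin \o F k).
  by apply: continuous_integrable; apply: continuous_subspaceT; exact: cF.
elim: n => [|n IHn].
  rewrite big_geq// (@eq_Rintegral _ _ _ P _ (cst 0)).
    by rewrite Rintegral_cst ?mul0r//; exact: measurable_I01.
  by move=> x _; rewrite big_geq.
rewrite big_nat_recr//= -IHn -(RintegralZl _ (@measurable_I01 R))//.
rewrite -RintegralD.
- by apply: eq_Rintegral => x _; rewrite big_nat_recr.
- exact: measurable_I01.
- by apply: continuous_integrable; apply: continuous_subspaceT; exact: continuous_lincomb.
- exact: (integrableZl (@measurable_I01 R) (a n) (iF n)).
Qed.

Lemma law_bound P (L : step R) f (C : R) : step_law P L ->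
  {within I01 R, continuous f} -> (forall x, I01 R x -> `|f x| <= C) ->
  `|step_int L f| <= C.
Proof.
move=> [P1 _ _ Pint] cf fC; rewrite -Pint//.
have c0 : {within I01 R, continuous (cst 0 : R -> R)}.
  by apply: continuous_subspaceT => x; exact: cvg_cst.
have := @Rintegral_dist P f (cst 0) C P1 cf c0.
rewrite (Rintegral_cst P (@measurable_I01 R) 0) mul0r subr0; apply => x Ix /=.
by rewrite subr0 fC.
Qed.

Section Grid.
Variable M : nat.
Hypothesis M_gt0 : (0 < M)%N.
Let Mr : R := M%:R.
Let N : R := M.+1%:R.
Let Mr0 : 0 < Mr. Proof. by rewrite ltr0n. Qed.
Let NE : N = Mr + 1. Proof. by rewrite /N -natr1. Qed.

(** The tent of height 1 at [k / M], as a second difference of [ramp]. On the unit interval the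
    tents sum to 1 and interpolate affine functions exactly, so sweeping keeps mass and mean. *)
Definition hat k x : R :=
  ramp (Mr * x - (k%:R - 1)) - 2 * ramp (Mr * x - k%:R) + ramp (Mr * x - (k%:R + 1)).

Lemma hat_continuous k : continuous (hat k).
Proof.
have c a : continuous (fun x => ramp (Mr * x - a)).
  suff cts x : {for x, continuous (fun x => ramp (Mr * x - a))} by move=> x; exact: cts.
  apply: (@continuous_comp _ _ _ (fun x => Mr * x) (fun y => ramp (y - a))).
    by apply: cvgM; [exact: cvg_cst|exact: cvg_id].
  exact: ramp_continuous.
move=> x; apply: cvgD; last exact: c.
by apply: cvgB; [exact: c|apply: cvgM; [exact: cvg_cst|exact: c]].
Qed.

Lemma hat_ge0 k x : 0 <= hat k x.
Proof.
rewrite /hat /ramp; set y := Mr * x; set z := k%:R.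
by case: (ler0P (y - (z - 1))); case: (ler0P (y - z)); case: (ler0P (y - (z + 1))); lra.
Qed.

Lemma hat_eq0 k x : 1 <= `|Mr * x - k%:R| -> hat k x = 0.
Proof.
rewrite /hat /ramp; set y := Mr * x; set z := k%:R.
by case: (ler0P (y - (z - 1))); case: (ler0P (y - z)); case: (ler0P (y - (z + 1))); lra.
Qed.

Lemma sum_hat_aux n x : \sum_(0 <= k < n.+1) hat k x =
  ramp (Mr * x + 1) - ramp (Mr * x) - (ramp (Mr * x - n%:R) - ramp (Mr * x - (n%:R + 1))).
Proof.
elim: n => [|n IHn].
  by rewrite big_nat1 /hat sub0r opprK subr0; lra.
by rewrite big_nat_recr//= IHn /hat -natr1 addrK; lra.
Qed.

Lemma sum_hat x : I01 R x -> \sum_(0 <= k < M.+1) hat k x = 1.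
Proof.
move=> /I01P/andP[x0 x1]; have Mx0 : 0 <= Mr * x by rewrite mulr_ge0// ltW.
have MxM : Mr * x <= Mr by rewrite ler_piMr// ltW.
rewrite sum_hat_aux -/Mr (ramp_ge0 (t := Mr * x + 1)); last lra.
by rewrite (ramp_ge0 Mx0) !ramp_le0; lra.
Qed.

Lemma sum_khat_aux n x : \sum_(0 <= k < n.+1) k%:R * hat k x =
  ramp (Mr * x) - (n%:R + 1) * ramp (Mr * x - n%:R) + n%:R * ramp (Mr * x - (n%:R + 1)).
Proof.
elim: n => [|n IHn]; first by rewrite big_nat1 subr0; lra.
by rewrite big_nat_recr//= IHn /hat -natr1 addrK; lra.
Qed.

Lemma sum_khat x : I01 R x -> \sum_(0 <= k < M.+1) k%:R * hat k x = Mr * x.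
Proof.
move=> /I01P/andP[x0 x1]; have Mx0 : 0 <= Mr * x by rewrite mulr_ge0// ltW.
have MxM : Mr * x <= Mr by rewrite ler_piMr// ltW.
rewrite sum_khat_aux -/Mr (ramp_ge0 Mx0) !ramp_le0; lra.
Qed.

Variable P : probability R R.
Hypotheses (P1 : on01 P) (Pmean : \int[P]_(x in I01 R) x = 2^-1).

Definition weight k : R := \int[P]_(x in I01 R) hat k x.

Lemma weight_ge0 k : 0 <= weight k.
Proof. by apply: Rintegral_ge0 => x _; exact: hat_ge0. Qed.

Lemma sum_weight : \sum_(0 <= k < M.+1) weight k = 1.
Proof.
transitivity (\sum_(0 <= k < M.+1) 1 * weight k).
  by apply: eq_bigr => k _; rewrite mul1r.
rewrite -Rintegral_lincomb; last exact: hat_continuous.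
rewrite (@eq_Rintegral _ _ _ P _ (cst 1)).
  by rewrite (Rintegral_cst P (@measurable_I01 R) 1) (congr1 fine P1) /= mulr1.
move=> x; rewrite inE => /sum_hat h; rewrite -[RHS]/(1 : R) -[RHS]h.
by apply: eq_bigr => k _; rewrite mul1r.
Qed.

Lemma sum_kweight : \sum_(0 <= k < M.+1) k%:R * weight k = Mr / 2.
Proof.
rewrite -Rintegral_lincomb; last exact: hat_continuous.
transitivity (\int[P]_(x in I01 R) (Mr * x)).
  by apply: eq_Rintegral => x; rewrite inE => /sum_khat.
rewrite RintegralZl ?Pmean//; first exact: measurable_I01.
by apply: continuous_integrable; apply: continuous_subspaceT => x; exact: cvg_id.
Qed.

(* Sweeps [P] onto the grid points [k/M] without moving its mean, then spreads
   the point [k/M] uniformly over [[k/N, (k+1)/N]], i.e. takes the law of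
   [(1 - 1/N) X + U/N] with [U] uniform on [[0, 1]]. *)
Definition balayage : step R :=
  [seq (weight k * N, (k%:R / N, (k%:R + 1) / N)) | k <- index_iota 0 M.+1].

Let N0 : 0 < N. Proof. by rewrite ltr0n. Qed.

Lemma balayage_admissible : admissible N^-1 balayage.
Proof.
have Ni : 0 < N^-1 by rewrite invr_gt0.
have NNi : N * N^-1 = 1 by rewrite divff// gt_eqF.
split.
- apply/allP => _ /mapP[k + ->] /=; rewrite mem_index_iota ltnS => /andP[_ kM].
  have kM' : k%:R <= Mr by rewrite ler_nat.
  apply/and3P; split; first by rewrite mulr_ge0// ltW.
    by rewrite ler_pM2r//; lra.
  by rewrite ler_pdivrMr// mul1r NE; lra.
(* Every endpoint is 0 or at least [1 / N], whereas all cells lie between 0 and [1 / N]. *)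
- have N1 : N^-1 <= 1 by rewrite invf_le1// ler1n.
  move=> r _ /mapP[k _ ->] /=.
  have el := edge_leh Ni r; have eg := edge_gt0 Ni r.
  have kN j : (0 < j)%N -> edge N^-1 r <= j%:R / N.
    by move=> j0; apply: le_trans el _; rewrite ler_peMl ?ler1n// ltW.
  split; last by right; rewrite natr1; exact: kN.
  by case: k => [|k]; [left; rewrite mul0r; lra|right; exact: kN].
- rewrite -sum_weight /incr big_map; apply: eq_bigr => k _ /=.
  by rewrite -mulrBl addrAC subrr add0r mul1r -mulrA NNi mulr1.
(* The mean is [(M / 2) / N + 1 / (2 * N)], which is 1/2 because [N = M + 1]. *)
- rewrite /incr big_map.
  transitivity (\sum_(0 <= k < M.+1) (N^-1 * (k%:R * weight k) + (2 * N)^-1 * weight k)).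
    by apply: eq_bigr => k _ /=; field; rewrite gt_eqF.
  rewrite big_split /= -!mulr_sumr sum_weight sum_kweight NE.
  by field; rewrite gt_eqF//; lra.
- move=> x; rewrite /dens big_map; apply: sumr_ge0 => k _ /=.
  by rewrite mulr_ge0 ?ler0n// mulr_ge0 ?weight_ge0// ltW.
Qed.

(** The swept integral is the [P]-integral of the sum of the [a k * hat k], with [a k] the average
    of [f] over [[k/N, (k+1)/N]]. Where [hat k x] is nonzero, that interval lies within [2 / M] of
    [x], so [a k] is within [e] of [f x]. *)
Lemma balayage_close f (e d : R) : {within I01 R, continuous f} ->
  (forall x y, I01 R x -> I01 R y -> `|x - y| < d -> `|f x - f y| <= e) ->
  2 / Mr < d ->
  `|step_int balayage f - \int[P]_(x in I01 R) f x| <= e.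
Proof.
move=> cf fe Md; have Ni : 0 < N^-1 by rewrite invr_gt0.
have NNi : N * N^-1 = 1 by rewrite divff// gt_eqF.
pose a k := N * \int[@lebesgue_measure R]_(x in `[k%:R / N, (k%:R + 1) / N]) f x.
have -> : step_int balayage f = \int[P]_(x in I01 R) (\sum_(0 <= k < M.+1) a k * hat k x).
  rewrite Rintegral_lincomb; last exact: hat_continuous.
  by rewrite /step_int big_map; apply: eq_bigr => k _ /=; rewrite -mulrA mulrC.
apply: Rintegral_dist => //.
  by apply: continuous_subspaceT; apply: continuous_lincomb; exact: hat_continuous.
move=> x Ix; rewrite -[f x]mul1r -(sum_hat Ix) mulr_suml -sumrB.
apply: le_trans (ler_norm_sum _ _ _) _.
rewrite -[e]mul1r -(sum_hat Ix) mulr_suml big_nat [leRHS]big_nat; apply: ler_sum => k.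
rewrite ltnS => /andP[_ kM]; rewrite [hat k x * f x]mulrC -mulrBl normrM.
rewrite (ger0_norm (hat_ge0 _ _)) mulrC.
have [far|near] := lerP 1 `|Mr * x - k%:R|; first by rewrite hat_eq0// !mul0r.
rewrite ler_wpM2l ?hat_ge0//.
have kM' : k%:R <= Mr by rewrite ler_nat.
have k0 : 0 <= k%:R :> R by rewrite ler0n.
have kN : k%:R / N <= (k%:R + 1) / N by rewrite ler_pM2r//; lra.
have sub y : k%:R / N <= y <= (k%:R + 1) / N -> I01 R y /\ `|f y - f x| <= e.
  move=> /andP[ky yk].
  have y0 : 0 <= y by apply: le_trans ky; rewrite mulr_ge0// ltW.
  have y1 : y <= 1 by apply: le_trans yk _; rewrite ler_pdivrMr// mul1r NE; lra.
  have Iy : I01 R y by apply/I01P/andP.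
  split => //; apply: fe => //; apply: le_lt_trans Md.
  rewrite ler_pdivlMr// -[Mr in _ * Mr](gtr0_norm Mr0) -normrM mulrBl.
  have h1 : k%:R <= y * N by rewrite -ler_pdivrMr.
  have h2 : y * N <= k%:R + 1 by rewrite -ler_pdivlMr.
  move: near; rewrite ltr_norml => /andP[h3 h4]; rewrite NE mulrDr mulr1 in h1 h2.
  by rewrite ler_norml; apply/andP; split; lra.
have Isub : `[k%:R / N, (k%:R + 1) / N] `<=` I01 R.
  by move=> y /=; rewrite in_itv/= => /sub[].
have [C _ fC] := continuous_bounded_I01 cf.
have mJ : measurable (`[k%:R / N, (k%:R + 1) / N]%classic : set (measurableTypeR R)).
  exact: measurable_itv.
have fi : (@lebesgue_measure R).-integrable `[k%:R / N, (k%:R + 1) / N] (EFin \o f).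
  apply: (@bounded_leb_integrable _ _ _ C) => //.
  exact: continuous_measurable_I01.
have ci (u : R) : (@lebesgue_measure R).-integrable `[k%:R / N, (k%:R + 1) / N] (EFin \o cst u).
  apply: (@bounded_leb_integrable _ _ _ `|u|) => //; exact: measurable_cst.
have cE (u : R) : \int[@lebesgue_measure R]_(y in `[k%:R / N, (k%:R + 1) / N]) cst u y = u / N.
  rewrite -[u in RHS]mulr1 -mulrA [1 / N](_ : _ = (k%:R + 1) / N - k%:R / N); last first.
    by rewrite -mulrBl addrAC subrr add0r.
  rewrite -int_one// -RintegralZl//; last exact: (ci 1).
  by apply: eq_Rintegral => y _; rewrite mulr1.
have up : a k <= f x + e.
  rewrite /a -ler_pdivlMl// [leRHS]mulrC -[leRHS]cE; apply: (le_Rintegral mJ fi (ci _)) => y.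
  by rewrite /= in_itv/= => /sub[_]; rewrite ler_norml => /andP[_ h]; lra.
have dn : f x - e <= a k.
  rewrite /a -ler_pdivrMl// [leLHS]mulrC -[leLHS]cE; apply: (le_Rintegral mJ (ci _) fi) => y.
  by rewrite /= in_itv/= => /sub[_]; rewrite ler_norml => /andP[h _]; lra.
by rewrite ler_norml; apply/andP; split; lra.
Qed.

End Grid.

End Balayage.

(** * Density *)

Section DenseUTOURM.
Context (R : realType).

Lemma injective_unbounded (g : nat -> nat) (B : nat) : injective g -> exists j, (B <= g j)%N.
Proof.
move=> g_inj; apply: contrapT => /forallNP small.
have : (size (map g (iota 0 B.+1)) <= size (iota 0 B))%N.
  apply: uniq_leq_size; first by rewrite map_inj_uniq ?iota_uniq.
  move=> _ /mapP[j _ ->]; rewrite mem_iota add0n leq0n /= ltnNge; apply/negP.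
  exact: small.
by rewrite size_map !size_iota ltnn.
Qed.

(** The second component of the coded pair is a free counter, so every list is decoded from
    arbitrarily large numbers. *)
Definition decode (n : nat) : seq nat :=
  if unpickle n is Some p then (p : seq nat * nat).1 else [::].

Lemma decode_unbounded (A : seq nat) (B : nat) : exists2 n, (B <= n)%N & decode n = A.
Proof.
have [|j Bj] := @injective_unbounded (fun j => pickle (A, j)) B.
  by move=> i j /(pcan_inj pickleK)[].
by exists (pickle (A, j)) => //; rewrite /decode pickleK.
Qed.

Lemma UTOURM_dense : rel_dense (@UTOURM R).
Proof.
move=> mu M0 k idx fs eps [eps0 cfs]; have mu1 := M0seq_on01 M0.
have [C CP] : {C : 'I_k -> R & forall i, 0 < C i /\ forall x, I01 R x -> `|fs i x| <= C i}.
  apply: (@choice _ _ (fun i C => 0 < C /\ forall x, I01 R x -> `|fs i x| <= C)) => i.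
  by have [C C0 fC] := continuous_bounded_I01 (cfs i); exists C.
have e40 : 0 < eps / 4 by rewrite divr_gt0.
have [d dP] : {d : 'I_k -> R & forall i, 0 < d i /\ forall x y, I01 R x -> I01 R y ->
    `|x - y| < d i -> `|fs i x - fs i y| <= eps / 4}.
  apply: (@choice _ _ (fun i d => 0 < d /\ forall x y, I01 R x -> I01 R y ->
    `|x - y| < d -> `|fs i x - fs i y| <= eps / 4)) => i.
  have [d d0 fd] := within_continuous_uniform (cfs i) e40.
  by exists d; split => // x y Ix Iy xy; apply/ltW/fd.
(* Sums give bounds common to all test functions, also when [k = 0]. *)
pose Csum := \sum_i C i; pose dsum := \sum_i 2 / d i.
have C_sum i : C i <= Csum.
  rewrite /Csum (bigD1 i)//= lerDl sumr_ge0// => j _; exact/ltW/(CP j).1.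
have d_sum i : 2 / d i <= dsum.
  rewrite /dsum (bigD1 i)//= lerDl sumr_ge0// => j _.
  by rewrite divr_ge0// ltW//; exact: (dP j).1.
have Csum0 : 0 <= Csum by apply: sumr_ge0 => j _; exact/ltW/(CP j).1.
pose M := (Num.truncn dsum).+1; pose N : R := M.+1%:R.
pose h : R := N^-1.
have h0 : 0 < h by rewrite invr_gt0.
have h1 : h <= 1 by rewrite invf_le1// ler1n.
have Md i : 2 / M%:R < d i.
  rewrite ltr_pdivrMr ?ltr0n// mulrC -ltr_pdivrMr; last exact: (dP i).1.
  exact: le_lt_trans (d_sum i) (truncnS_gt _).
(* This gives [0 < eta <= 1] and [eta * (2 * Csum) <= eps / 4], the latter bounding the effect of
   the mixture on a test integral. *)
pose eta : R := eps / (8 * Csum + eps).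
have den0 : 0 < 8 * Csum + eps by rewrite ltr_wpDl// mulr_ge0.
have eta0 : 0 < eta by rewrite divr_gt0.
have eta1 : eta <= 1 by rewrite ler_pdivrMr// mul1r lerDr mulr_ge0.
have etaC : eta * (8 * Csum) <= eps.
  by rewrite /eta mulrAC ler_pdivrMr// ler_pM2l// lerDl ltW.
pose K := (\max_i idx i).+1.
have idxK i : (idx i < K)%N by rewrite ltnS; exact: leq_bigmax.
pose b n := if (n < K)%N then balayage M (mu n) else unif01 R.
have bA n : admissible h (b n).
  rewrite /b; case: ifP => _; last exact: admissible_unif01.
  by apply: balayage_admissible => //; apply: proper_mean; have [] := M0 n.
pose p n m := pairing (b n) (b m) - 2^-1.
(* The sign follows the unperturbed form when that is nonzero, so the two terms of [pwE] never
   cancel; otherwise it is free and encodes membership in [decode n]. *)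
pose c n m : R := if 0 < p n m then 1 else if p n m < 0 then -1
  else if m \in decode n then 1 else -1.
have c1 n m : `|c n m| <= 1.
  by rewrite /c; do ![case: ifP => _]; rewrite ?normrN normr1.
pose L n := mixt h eta (b n) (c n) n.
have [nu nuP] : {nu : nat -> probability R R & forall n, wf_step (L n) /\
    [/\ step_law (nu n) (L n), in_M0 (nu n) & continuous_meas (nu n)]}.
  apply: (@choice _ _ (fun n P => wf_step (L n) /\
    [/\ step_law P (L n), in_M0 P & continuous_meas P])) => n.
  have [wL [P PP]] := mixt_law h0 h1 n eta0 eta1 (bA n) (c1 n).
  by exists P.
have nu1 n : on01 (nu n) by have [_ [[]]] := nuP n.
have nu0 n : atomless (nu n) by have [_ [[]]] := nuP n.
pose w m := eta ^+ 2 / 16 * (edge h m / 8) ^+ 2.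
have w0 m : 0 < w m.
  rewrite mulr_gt0// ?divr_gt0 ?exprn_gt0//.
  by rewrite divr_gt0// edge_gt0.
have pwE n m : (m < n)%N ->
    pw (nu n) (nu m) - 2^-1 = (1 - eta) ^+ 2 * p n m + c n m * w m.
  move=> mn; have [wL [Ln _ _]] := nuP n; have [_ [Lm _ _]] := nuP m.
  rewrite (pw_step wL Ln Lm) -/(pairing _ _) (pairing_mixt h0 h1)// /w.
  by rewrite [in RHS]mulrCA.
have sq0 : 0 <= (1 - eta) ^+ 2 by exact: sqr_ge0.
have notie n m : (m < n)%N -> pw (nu n) (nu m) != 2^-1.
  move=> mn; rewrite -subr_eq0 (pwE _ _ mn); have wm := w0 m.
  rewrite /c; case: ltrP => [p0|p0]; last case: ltrP => [p0'|p0'].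
  - by rewrite gt_eqF// mul1r ltr_wpDl// mulr_ge0// ltW.
  - by rewrite lt_eqF// mulN1r subr_lt0 (le_lt_trans _ wm)// nmulr_lle0 ?mulr_ge0_le0// ltW.
  - have -> : p n m = 0 by apply/le_anti; rewrite p0 p0'.
    by rewrite mulr0 add0r; case: ifP => _; rewrite ?mul1r ?mulN1r ?oppr_eq0 gt_eqF.
have Utot i j : i <> j -> Udigraph nu i j \/ Udigraph nu j i.
  move=> ij; have sum1 := pwD (nu1 i) (nu1 j) (nu0 i).
  have tie : pw (nu i) (nu j) != 2^-1.
    have [ij'|ij'|//] := ltngtP i j; last exact: notie.
    by apply/eqP => h2; have /eqP := notie _ _ ij'; apply; lra.
  have [lt|gt|eq] := ltgtP (pw (nu i) (nu j)) 2^-1; last by rewrite eq eqxx in tie.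
  - by right; apply/UdigraphE => //; split; [exact: nesym|lra].
  - by left; apply/UdigraphE.
have nuM0 : in_M0seq nu by move=> n; have [_ []] := nuP n.
exists nu; split.
  split; first by move=> n; have [_ []] := nuP n.
  apply: ext_universal; first exact: Udigraph_tournament.
  (* A number [v] coding [A] beyond this bound has a uniform base law and exceeds all of [A] and
     [B]. Hence [p v m = 0], and the sign of the form at [(v, m)] is given by membership in [A]. *)
  move=> A B AB; pose bound := (K + \sum_(a <- A ++ B) a.+1)%N.
  have [v bv vA] := decode_unbounded A bound.
  have Kv : (K <= v)%N by apply: leq_trans bv; exact: leq_addr.
  have ltv a : a \in A ++ B -> (a < v)%N.
    move=> aAB; apply: leq_trans bv; rewrite /bound (big_rem a)//=.
    by rewrite addnA addnAC; apply: leq_trans (leq_addl _ _).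
  have pv m : p v m = 0.
    rewrite /p {1}/b ltnNge Kv /=; have [wb _ b1 b2 _] := bA m.
    by rewrite pairing_unif01l// b1 b2; lra.
  have pwv m : (m < v)%N -> pw (nu v) (nu m) - 2^-1 = (if m \in A then 1 else -1) * w m.
    by move=> mv; rewrite pwE// /c pv ltxx mulr0 add0r vA.
  exists v; split.
  - by apply/negP => vA'; have := ltv v; rewrite mem_cat vA' ltnn => /(_ isT).
  - by apply/negP => vB'; have := ltv v; rewrite mem_cat vB' orbT ltnn => /(_ isT).
  - move=> a aA; have av : (a < v)%N by apply: ltv; rewrite mem_cat aA.
    have := pwv a av; rewrite aA mul1r => h2; have wa := w0 a.
    by apply/UdigraphE => //; split; [move=> va; rewrite va ltnn in av|lra].
  - move=> a aB; have av : (a < v)%N by apply: ltv; rewrite mem_cat aB orbT.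
    have aA : a \notin A by apply/negP => /AB; rewrite aB.
    have := pwv a av; rewrite (negbTE aA) mulN1r => h2; have wa := w0 a.
    have := pwD (nu1 v) (nu1 a) (nu0 v) => h3.
    by apply/UdigraphE => //; split; [move=> va; rewrite va ltnn in av|lra].
(* Sweeping moves the test integral by at most [eps / 4], and mixing with [rho] by at most [eps / 4]
   more. *)
move=> i; rewrite test_int_dist//.
have [_ [[_ _ _ nuint] _ _]] := nuP (idx i); rewrite nuint//.
set n := idx i; set f := fs i.
have -> : step_int (L n) f = (1 - eta) * step_int (b n) f + eta * step_int (rho h (c n) n) f.
  by rewrite step_int_cat !step_int_scale.
have bC : `|step_int (b n) f| <= Csum.
  have [P PP] := admissible_law (bA n); apply: (law_bound PP (cfs i)) => x Ix.
  exact: le_trans ((CP i).2 x Ix) (C_sum i).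
have rC : `|step_int (rho h (c n) n) f| <= Csum.
  have [P PP] := rho_law h0 h1 n (c1 n); apply: (law_bound PP (cfs i)) => x Ix.
  exact: le_trans ((CP i).2 x Ix) (C_sum i).
have bnE : b n = balayage M (mu n) by rewrite /b idxK.
have close : `|step_int (b n) f - \int[mu n]_(x in I01 R) f x| <= eps / 4.
  rewrite bnE; apply: (@balayage_close _ _ _ _ _ _ _ (d i)) => //; first exact: cfs.
  exact: (dP i).2.
move: bC rC close; rewrite !ler_norml => /andP[l1 u1] /andP[l2 u2] /andP[l3 u3].
set sb := step_int (b n) f in l1 u1 l3 u3 *; set sr := step_int _ f in l2 u2 *.
have e1 := ler_wpM2l (ltW eta0) l1; have e2 := ler_wpM2l (ltW eta0) u1.
have e3 := ler_wpM2l (ltW eta0) l2; have e4 := ler_wpM2l (ltW eta0) u2.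
by rewrite ltr_norml; apply/andP; split; lra.
Qed.

End DenseUTOURM.

Theorem theorem5p15 (R : realType) :
  rel_dense (@UTOURM R) /\ rel_Gdelta (@UTOURM R).
Proof. by split; [exact: UTOURM_dense|exact: UTOURM_Gdelta]. Qed.
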